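(* Let $\mathbf{K}$ be an algebraically closed field of characteristic $p\ge 0$. Let $f\in\mathbf{K}[[x,y]]$ be a reduced power series and let $l\in\mathbf{K}[[x,y]]$ be a regular parameter that does not divide $f$. Suppose that (i) $i_0(f,l)\not\equiv 0\pmod p$, and (ii) for any irreducible factor $h$ of $\mathcal{P}_l(f)$ we have $i_0(l,h)\not\equiv 0\pmod p$. Then $$i_0(f,\mathcal{P}_l(f))\le \mu(f)+i_0(f,l)-1,$$ with equality if and only if (iii) for any irreducible factor $h$ of $\mathcal{P}_l(f)$ we have $i_0(f,h)\not\equiv 0\pmod p$.
   Context: A power series is reduced if it has no multiple factors. A regular parameter is a power series $l\in\mathbf{K}[[x,y]]$ of order one. The polar of $f$ with respect to $l$ is $\mathcal{P}_l(f)=\frac{\partial f}{\partial x}\frac{\partial l}{\partial y}-\frac{\partial f}{\partial y}\frac{\partial l}{\partial x}$. For $f,g\in\mathbf{K}[[x,y]]$, $i_0(f,g)=\dim_{\mathbf{K}}\mathbf{K}[[x,y]]/(f,g)$ is the intersection number, and $\mu(f)=i_0\left(\frac{\partial f}{\partial x},\frac{\partial f}{\partial y}\right)\in\mathbb{N}\cup\{+\infty\}$ is the Milnor number. If $p=0$, $a\not\equiv 0\pmod p$ means $a\ne 0$. *)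

(* Defs.v *)
From HB Require Import structures.
From mathcomp Require Import all_boot all_order all_algebra.
From mathcomp Require Import boolp classical_sets.
From mathcomp Require Import constructive_ereal.

Set Implicit Arguments.
Unset Strict Implicit.
Unset Printing Implicit Defensive.

Import GRing.Theory.
Local Open Scope ring_scope.

(* [f i j] is the coefficient of x^i y^j. *)
Record fps2 (K : Type) := FPS2 { coef2 :> nat -> nat -> K }.

Lemma fps2P (K : Type) (f g : fps2 K) : (forall i j, f i j = g i j) -> f = g.
Proof.
case: f g => f [g] /= fg; congr FPS2.
by apply/funext => i; apply/funext => j; exact: fg.
Qed.

HB.instance Definition _ (K : Type) := gen_eqMixin (fps2 K).
HB.instance Definition _ (K : Type) := gen_choiceMixin (fps2 K).

Section Fps2Ring.
Variable K : fieldType.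
Implicit Types f g h : fps2 K.

Definition fps2_zero : fps2 K := FPS2 (fun _ _ => 0).
Definition fps2_opp f : fps2 K := FPS2 (fun i j => - f i j).
Definition fps2_add f g : fps2 K := FPS2 (fun i j => f i j + g i j).
Definition fps2_one : fps2 K :=
  FPS2 (fun i j => ((i == 0%N) && (j == 0%N))%:R).
Definition fps2_mul f g : fps2 K :=
  FPS2 (fun i j => \sum_(a < i.+1) \sum_(b < j.+1) f a b * g (i - a)%N (j - b)%N).
Definition fps2_scale (c : K) f : fps2 K := FPS2 (fun i j => c * f i j).

Lemma fps2_addA : associative fps2_add.
Proof. by move=> f g h; apply: fps2P => i j /=; rewrite addrA. Qed.

Lemma fps2_addC : commutative fps2_add.
Proof. by move=> f g; apply: fps2P => i j /=; rewrite addrC. Qed.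

Lemma fps2_add0 : left_id fps2_zero fps2_add.
Proof. by move=> f; apply: fps2P => i j /=; rewrite add0r. Qed.

Lemma fps2_addN : left_inverse fps2_zero fps2_opp fps2_add.
Proof. by move=> f; apply: fps2P => i j /=; rewrite addNr. Qed.

HB.instance Definition _ := GRing.isZmodule.Build (fps2 K)
  fps2_addA fps2_addC fps2_add0 fps2_addN.

(* Truncations turn the ring axioms into those of [{poly {poly K}}]. *)
Let trunc n f : {poly {poly K}} := \poly_(i < n) \poly_(j < n) f i j.

Let coef_trunc n f i j :
  (i < n)%N -> (j < n)%N -> (trunc n f)`_i`_j = f i j.
Proof. by move=> lt_in lt_jn; rewrite !(coef_poly, lt_in, lt_jn). Qed.

Let coef2M (P Q : {poly {poly K}}) i j :
  (P * Q)`_i`_j =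
  \sum_(a < i.+1) \sum_(b < j.+1) P`_a`_b * Q`_(i - a)`_(j - b).
Proof. by rewrite coefM coef_sum; apply: eq_bigr => a _; rewrite coefM. Qed.

Let mul_agree n f g (P Q : {poly {poly K}}) :
    (forall i j, (i < n)%N -> (j < n)%N -> P`_i`_j = f i j) ->
    (forall i j, (i < n)%N -> (j < n)%N -> Q`_i`_j = g i j) ->
  forall i j, (i < n)%N -> (j < n)%N -> (P * Q)`_i`_j = fps2_mul f g i j.
Proof.
move=> Pf Qg i j lt_in lt_jn; rewrite coef2M /=.
apply: eq_bigr => -[a /= le_ai] _; apply: eq_bigr => -[b /= le_bj] _.
rewrite Pf ?Qg //; first exact: leq_ltn_trans (leq_subr _ _) lt_in.
- exact: leq_ltn_trans (leq_subr _ _) lt_jn.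
- exact: leq_ltn_trans (le_ai : (a <= i)%N) lt_in.
- exact: leq_ltn_trans (le_bj : (b <= j)%N) lt_jn.
Qed.

Lemma fps2_mulA : associative fps2_mul.
Proof.
move=> f g h; apply: fps2P => i j.
pose n := (maxn i j).+1.
have lt_in : (i < n)%N by rewrite ltnS leq_maxl.
have lt_jn : (j < n)%N by rewrite ltnS leq_maxr.
have tr u := @coef_trunc n u.
rewrite -(mul_agree (tr f) (mul_agree (tr g) (tr h))) //.
by rewrite -(mul_agree (mul_agree (tr f) (tr g)) (tr h)) // mulrA.
Qed.

Lemma fps2_mulC : commutative fps2_mul.
Proof.
move=> f g; apply: fps2P => i j.
pose n := (maxn i j).+1.
have lt_in : (i < n)%N by rewrite ltnS leq_maxl.
have lt_jn : (j < n)%N by rewrite ltnS leq_maxr.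
have tr u := @coef_trunc n u.
by rewrite -(mul_agree (tr f) (tr g)) // -(mul_agree (tr g) (tr f)) // mulrC.
Qed.

Lemma fps2_mul1 : left_id fps2_one fps2_mul.
Proof.
move=> f; apply: fps2P => i j /=.
rewrite big_ord_recl big_ord_recl /= mul1r !subn0 big1 ?addr0.
  by rewrite big1 ?addr0 // => a _; rewrite big1 // => b _; rewrite mul0r.
by move=> b _; rewrite mul0r.
Qed.

Lemma fps2_mulDl : left_distributive fps2_mul +%R.
Proof.
move=> f g h; apply: fps2P => i j /=.
rewrite -big_split; apply: eq_bigr => a _ /=.
by rewrite -big_split; apply: eq_bigr => b _ /=; rewrite mulrDl.
Qed.

Lemma fps2_oner_neq0 : fps2_one != 0.
Proof.
apply/eqP => /(congr1 (fun f : fps2 K => f 0%N 0%N)) /= /eqP.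
by rewrite oner_eq0.
Qed.

HB.instance Definition _ := GRing.Zmodule_isComNzRing.Build (fps2 K)
  fps2_mulA fps2_mulC fps2_mul1 fps2_mulDl fps2_oner_neq0.

Lemma fps2_scalerA a b f :
  fps2_scale a (fps2_scale b f) = fps2_scale (a * b) f.
Proof. by apply: fps2P => i j /=; rewrite mulrA. Qed.

Lemma fps2_scale1r : left_id 1 fps2_scale.
Proof. by move=> f; apply: fps2P => i j /=; rewrite mul1r. Qed.

Lemma fps2_scalerDr : right_distributive fps2_scale +%R.
Proof. by move=> a f g; apply: fps2P => i j /=; rewrite mulrDr. Qed.

Lemma fps2_scalerDl f : {morph fps2_scale^~ f : a b / a + b}.
Proof. by move=> a b; apply: fps2P => i j /=; rewrite mulrDl. Qed.

HB.instance Definition _ := GRing.Zmodule_isLmodule.Build K (fps2 K)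
  fps2_scalerA fps2_scale1r fps2_scalerDr fps2_scalerDl.

Lemma fps2_scalerAl (c : K) (f g : fps2 K) : c *: (f * g) = (c *: f) * g.
Proof.
apply: fps2P => i j /=; rewrite mulr_sumr; apply: eq_bigr => a _.
by rewrite mulr_sumr; apply: eq_bigr => b _; rewrite mulrA.
Qed.

HB.instance Definition _ :=
  GRing.Lmodule_isLalgebra.Build K (fps2 K) fps2_scalerAl.
HB.instance Definition _ := GRing.Lalgebra_isComAlgebra.Build K (fps2 K).

Definition fps2_unit : {pred fps2 K} := fun f => `[< exists g, g * f = 1 >].
Definition fps2_inv f : fps2 K :=
  if pselect (exists g, g * f = 1) is left ex then projT1 (cid ex) else f.

Lemma fps2_mulVx : {in fps2_unit, left_inverse 1 fps2_inv *%R}.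
Proof.
move=> f /asboolP ex; rewrite /fps2_inv; case: pselect => [e|//].
by case: (cid e).
Qed.

Lemma fps2_unitPl f g : g * f = 1 -> fps2_unit f.
Proof. by move=> gf1; apply/asboolP; exists g. Qed.

Lemma fps2_invr_out : {in [predC fps2_unit], fps2_inv =1 id}.
Proof.
move=> f /negP nex; rewrite /fps2_inv; case: pselect => // e.
by case: nex; apply/asboolP.
Qed.

HB.instance Definition _ := GRing.ComNzRing_hasMulInverse.Build (fps2 K)
  fps2_mulVx fps2_unitPl fps2_invr_out.

End Fps2Ring.

Definition divides (R : comUnitRingType) (a b : R) : Prop :=
  exists c, b = c * a.

Definition irreducible (R : comUnitRingType) (a : R) : Prop :=
  [/\ a != 0, a \isn't a GRing.unit &
      forall b c, a = b * c -> b \is a GRing.unit \/ c \is a GRing.unit].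

Definition irreducible_factor (R : comUnitRingType) (h a : R) : Prop :=
  irreducible h /\ divides h a.

Definition reduced (R : comUnitRingType) (a : R) : Prop :=
  forall h, irreducible h -> ~ divides (h ^+ 2) a.

(* The classes modulo [W] of the [s i] form a basis of the quotient V/W. *)
Definition basis_mod (K : fieldType) (V : lmodType K) (W : set V)
    (n : nat) (s : 'I_n -> V) : Prop :=
  forall v, exists! c : 'rV[K]_n, W (v - \sum_(i < n) c ord0 i *: s i).

(* Values in \N \cup {+oo}, seen inside [\bar int]. *)
Definition quotient_dim (K : fieldType) (V : lmodType K) (W : set V) :
    \bar int :=
  if pselect (exists n, exists s : 'I_n -> V, basis_mod W s) is left ex
  then (Posz (projT1 (cid ex)))%:E else +oo%E.

Definition ideal2 (R : comUnitRingType) (a b : R) : set R :=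
  [set r | exists u v, r = u * a + v * b]%classic.

Section PlaneCurves.
Variable K : fieldType.
Implicit Types f g l : fps2 K.

Definition dx f : fps2 K := FPS2 (fun i j => f i.+1 j *+ i.+1).
Definition dy f : fps2 K := FPS2 (fun i j => f i j.+1 *+ j.+1).

Definition has_order f (n : nat) : Prop :=
  (forall i j, (i + j < n)%N -> f i j = 0) /\
  (exists i j, (i + j)%N = n /\ f i j != 0).

Definition regular_parameter l : Prop := has_order l 1.

Definition polar l f : fps2 K := dx f * dy l - dy f * dx l.

Definition i0 f g : \bar int := quotient_dim (ideal2 f g).

Definition milnor f : \bar int := i0 (dx f) (dy f).

End PlaneCurves.

Definition has_char (K : fieldType) (p : nat) : Prop :=
  if p is 0 then [pchar K] =i pred0 else p \in [pchar K].

(* For [p = 0], [m = n %[mod p]] means [m = n].  An infinite [a] is taken to be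
   non congruent to 0. *)
Definition not_cong0 (p : nat) (a : \bar int) : Prop :=
  if a is n%:E then (n <> 0 %[mod p])%Z else True.

(* Main.v *)
Require Import Defs.
From HB Require Import structures.
From mathcomp Require Import all_boot all_order all_algebra.
From mathcomp Require Import boolp classical_sets.
From mathcomp Require Import constructive_ereal.
From mathcomp Require Import zify ring.

Set Implicit Arguments.
Unset Strict Implicit.
Unset Printing Implicit Defensive.

Import GRing.Theory.
Local Open Scope ring_scope.

(** The inequality is local along the irreducible factors h of the polar
P = P_l(f), and there it is the statement that differentiation in K[[t]] lowers
orders by exactly one when the order is nonzero in K, and by less otherwise.

Parametrize the branch h = 0 by an arc, a morphism of K-algebras
phi : K[[x,y]] -> K[[t]] with phi h = 0.  Where P vanishes the gradients of f
and l are parallel.  Since one partial derivative of l is a unit eps, there is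
a single series q (the matching partial derivative of f) such that
(f_x, f_y) = (q, P) as ideals and, by the chain rule,
(phi f)' * phi eps = phi q * (phi l)' (lemma [conormal]).  As ord (phi l) is
nonzero in K by (ii), comparing orders gives
ord (phi f) <= ord (phi q) + ord (phi l), with equality exactly when
ord (phi f) is nonzero in K.  Intersection numbers are additive over the
factors of P ([codim_mul_irreducible]), so summing over them gives
i0(f,P) <= i0(q,P) + i0(l,P), where i0(q,P) = mu(f).  Finally, along an arc of
the smooth curve l = 0 the chain rule reads (phi f)' = unit * phi P, whence
i0(l,P) = i0(f,l) - 1 by (i).  When q shares a factor h with P, mu(f) is
infinite and (phi f)' = 0, so that h violates (iii); f itself shares no factor
with P because it is reduced.

This needs three facts on arcs, valid in every characteristic.

Existence ([has_arc_ex]): blow up the origin repeatedly at a root of the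
leading form.  Either the order of h drops and induction applies, or it stays
equal to m for ever; then the chosen slopes c_1, c_2, ... make h(t, c_1 t +
c_2 t^2 + ...) divisible by every power of t^m, so it vanishes.

Kernel ([arc_kernel]): the kernel of an arc is prime, and Weierstrass division
by a kernel element of minimal order in y shows that it is principal, hence
generated by h when h is irreducible.  This makes irreducible series prime
without any appeal to unique factorization.

Intersection numbers ([codim_ordn]): i0(g,h) is a constant multiple of
ord (phi g).  Both are additive in g, so it is enough that ord (phi g2) <=
ord (phi g1) implies i0(g2,h) <= i0(g1,h).  The quotient u of phi g1 by phi g2
is integral over the image of phi, so an ideal J of finite codimension is
stable under u, which gives the inclusion g1 J + (h) <= g2 J + (h) while
codim (g J + (h)) = i0(g,h) + codim J.  That the ratio kappa is an integer
comes from building the arc together with two elements whose orders differ by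
one; by (ii), kappa is nonzero in K, so that congruences pass between orders
and intersection numbers. *)

(** * Codimension of subspaces *)

Section Codim.
Variable K : fieldType.

Definition subspace (V : lmodType K) (W : V -> Prop) : Prop :=
  W 0 /\ forall a u v, W u -> W v -> W (a *: u + v).

Definition codim (V : lmodType K) (W : set V) n : Prop :=
  exists s : 'I_n -> V, basis_mod W s.

Section Subspace.
Variables (V : lmodType K) (W : V -> Prop).
Hypothesis sW : subspace W.

Lemma subspaceD u v : W u -> W v -> W (u + v).
Proof. by case: sW => _ h wu wv; rewrite -[u]scale1r; apply: h. Qed.

Lemma subspaceZ a u : W u -> W (a *: u).
Proof. by case: sW => w0 h wu; rewrite -[_ *: _]addr0; apply: h. Qed.

Lemma subspaceB u v : W u -> W v -> W (u - v).
Proof.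
by move=> wu wv; apply: subspaceD => //; rewrite -scaleN1r; apply: subspaceZ.
Qed.

Lemma subspace_sum n (F : 'I_n -> V) :
  (forall i, W (F i)) -> W (\sum_(i < n) F i).
Proof.
move=> wF; apply: (big_ind W) => //; first by case: sW.
exact: subspaceD.
Qed.

End Subspace.

(** The matrices expressing each basis in the other one multiply to the
identity in one order, because coordinates modulo W' are unique. *)
Lemma le_codim (V : lmodType K) (W W' : V -> Prop) n m :
  subspace W' -> (forall v, W v -> W' v) -> codim W n -> codim W' m ->
  (m <= n)%N.
Proof.
move=> sW' WW' [s bs] [s' bs'].
have ex (j : 'I_m) := cid (bs (s' j)).
have ex' (i : 'I_n) := cid (bs' (s i)).
pose N := \matrix_(j < m) projT1 (ex j).
pose M := \matrix_(i < n) projT1 (ex' i).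
apply: (@mulmx1_min _ _ _ N M).
apply/row_matrixP => j; rewrite rowE -rowE row1.
have [c [_ uc]] := bs' (s' j).
transitivity c; last first.
  apply: uc; rewrite (bigD1 j) //= mxE !eqxx scale1r big1 ?addr0 ?subrr.
    by case: sW'.
  by move=> i /negPf ij; rewrite mxE ij andbF scale0r.
apply/esym/uc.
have [/WW' wj _] := projT2 (ex j).
set u := \sum_i _ in wj.
rewrite -[s' j](subrK u) -addrA; apply: subspaceD => //.
have -> : \sum_(i < m) row j (N *m M) ord0 i *: s' i =
  \sum_(i < n) N j i *: \sum_(k < m) M i k *: s' k.
  under eq_bigr => i _ do rewrite !mxE scaler_suml.
  rewrite exchange_big; apply: eq_bigr => i _; rewrite scaler_sumr.
  by apply: eq_bigr => k _; rewrite scalerA.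
have -> : u = \sum_(i < n) N j i *: s i.
  by apply: eq_bigr => i _; rewrite !mxE.
rewrite -sumrB; apply: subspace_sum => // i.
rewrite -scalerBr; apply: subspaceZ => //.
have [wi _] := projT2 (ex' i).
by under eq_bigr => k _ do rewrite mxE.
Qed.

Lemma codim_uniq (V : lmodType K) (W : V -> Prop) n m :
  subspace W -> codim W n -> codim W m -> n = m.
Proof.
by move=> sW bn bm; apply/eqP; rewrite eqn_leq !(@le_codim _ W W).
Qed.

Lemma quotient_dimE (V : lmodType K) (W : V -> Prop) n :
  subspace W -> codim W n -> quotient_dim W = (Posz n)%:E.
Proof.
move=> sW bn; rewrite /quotient_dim; case: pselect => [ex|nex].
  by case: (cid ex) => m /= bm; rewrite (codim_uniq sW bn bm).
by case: nex; exists n.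
Qed.

Lemma quotient_dim_oo (V : lmodType K) (W : V -> Prop) :
  (forall n, ~ codim W n) -> quotient_dim W = +oo%E.
Proof.
move=> nW; rewrite /quotient_dim; case: pselect => // -[n ex].
by case: (nW n).
Qed.

Lemma codimT (V : lmodType K) (W : V -> Prop) : (forall v, W v) -> codim W 0.
Proof.
by move=> WT; exists (fun=> 0) => v; exists 0; split=> // c _; rewrite thinmx0.
Qed.

(** Exactness of 0 -> U/WU -> V/W -> V/W' -> 0, the form in which every
additivity of intersection numbers is obtained. *)
Lemma codimD (U V : lmodType K) (g : {linear U -> V})
    (WU : U -> Prop) (W W' : V -> Prop) n m :
  subspace WU -> subspace W -> subspace W' ->
  (forall u, W (g u) <-> WU u) ->
  (forall v, W' v <-> exists u, W (v - g u)) ->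
  codim WU n -> codim W' m -> codim W (n + m).
Proof.
move=> sU sW sW' WUP W'P [s bs] [s' bs'].
(* The image of a basis of U/WU followed by lifts of a basis of V/W'. *)
pose S i := match split i with inl a => g (s a) | inr b => s' b end.
have sumS (c : 'rV[K]_(n + m)) : \sum_i c ord0 i *: S i =
    g (\sum_i lsubmx c ord0 i *: s i) + \sum_i rsubmx c ord0 i *: s' i.
  rewrite big_split_ord /= linear_sum; congr +%R; apply: eq_bigr => i _.
    by rewrite linearZ /S (unsplitK (inl i)) mxE.
  by rewrite /S (unsplitK (inr i)) mxE.
exists S => v.
have [c' [wc' uc']] := bs' v.
have [u wu] := (W'P _).1 wc'.
have [c [wc uc]] := bs u.
exists (row_mx c c'); split.
  rewrite sumS row_mxKl row_mxKr.
  have := subspaceD sW wu ((WUP _).2 wc); rewrite linearB.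
  by rewrite addrA subrK -addrA -opprD [X in - X]addrC.
move=> d; rewrite sumS => wd; rewrite -[d]hsubmxK.
have ed' : c' = rsubmx d.
  apply: uc'; apply/W'P; exists (\sum_i lsubmx d ord0 i *: s i).
  by rewrite -addrA -opprD [X in - X]addrC.
congr row_mx => //; apply: uc; apply/WUP; rewrite linearB.
rewrite ed' in wu; have := subspaceB sW wd wu.
set a := g (\sum_i _); set b := \sum_i _.
have -> : v - (a + b) = v - b - a by rewrite opprD addrA addrAC.
by rewrite opprB [_ - a + _]addrC subrKA.
Qed.

End Codim.

(** * Power series in one variable *)

Record fps1 (K : Type) := FPS1 { fps1_coef :> nat -> K }.

Lemma fps1P (K : Type) (f g : fps1 K) : (forall i, f i = g i) -> f = g.
Proof. by case: f g => f [g] fg; congr FPS1; apply/funext. Qed.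

HB.instance Definition _ (K : Type) := gen_eqMixin (fps1 K).
HB.instance Definition _ (K : Type) := gen_choiceMixin (fps1 K).

Section Fps1Ring.
Variable K : fieldType.
Implicit Types f g h : fps1 K.

Definition fps1_zero : fps1 K := FPS1 (fun=> 0).
Definition fps1_opp f : fps1 K := FPS1 (fun i => - f i).
Definition fps1_add f g : fps1 K := FPS1 (fun i => f i + g i).
Definition fps1_one : fps1 K := FPS1 (fun i => (i == 0%N)%:R).
Definition fps1_mul f g : fps1 K :=
  FPS1 (fun i => \sum_(a < i.+1) f a * g (i - a)%N).
Definition fps1_scale (c : K) f : fps1 K := FPS1 (fun i => c * f i).

Lemma fps1_addA : associative fps1_add.
Proof. by move=> f g h; apply: fps1P => i /=; rewrite addrA. Qed.

Lemma fps1_addC : commutative fps1_add.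
Proof. by move=> f g; apply: fps1P => i /=; rewrite addrC. Qed.

Lemma fps1_add0 : left_id fps1_zero fps1_add.
Proof. by move=> f; apply: fps1P => i /=; rewrite add0r. Qed.

Lemma fps1_addN : left_inverse fps1_zero fps1_opp fps1_add.
Proof. by move=> f; apply: fps1P => i /=; rewrite addNr. Qed.

HB.instance Definition _ := GRing.isZmodule.Build (fps1 K)
  fps1_addA fps1_addC fps1_add0 fps1_addN.

(** Ring axioms are transported from polynomials that coincide with the series
up to a given degree. *)
Definition agree1 n f (P : {poly K}) := forall i, (i < n)%N -> P`_i = f i.

Lemma agree1_poly n f : agree1 n f (\poly_(i < n) f i).
Proof. by move=> i lt_in; rewrite coef_poly lt_in. Qed.

Lemma agree1M n f g P Q :
  agree1 n f P -> agree1 n g Q -> agree1 n (fps1_mul f g) (P * Q).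
Proof.
move=> Pf Qg i lt_in; rewrite coefM /=.
apply: eq_bigr => -[a /= le_ai] _.
by rewrite Pf ?Qg //; apply: leq_ltn_trans lt_in; rewrite ?leq_subr.
Qed.

Lemma fps1_mulA : associative fps1_mul.
Proof.
move=> f g h; apply: fps1P => i; have tr u := @agree1_poly i.+1 u.
rewrite -(agree1M (tr f) (agree1M (tr g) (tr h))) //.
by rewrite -(agree1M (agree1M (tr f) (tr g)) (tr h)) // mulrA.
Qed.

Lemma fps1_mulC : commutative fps1_mul.
Proof.
move=> f g; apply: fps1P => i; have tr u := @agree1_poly i.+1 u.
by rewrite -(agree1M (tr f) (tr g)) // mulrC (agree1M (tr g) (tr f)).
Qed.

Lemma fps1_mul1 : left_id fps1_one fps1_mul.
Proof.
move=> f; apply: fps1P => i /=; rewrite big_ord_recl /= mul1r subn0.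
by rewrite big1 ?addr0 // => a _; rewrite mul0r.
Qed.

Lemma fps1_mulDl : left_distributive fps1_mul +%R.
Proof.
move=> f g h; apply: fps1P => i /=; rewrite -big_split.
by apply: eq_bigr => a _; rewrite mulrDl.
Qed.

Lemma fps1_oner_neq0 : fps1_one != 0.
Proof.
by apply/eqP => /(congr1 (fun f : fps1 K => f 0%N)) /= /eqP; rewrite oner_eq0.
Qed.

HB.instance Definition _ := GRing.Zmodule_isComNzRing.Build (fps1 K)
  fps1_mulA fps1_mulC fps1_mul1 fps1_mulDl fps1_oner_neq0.

Lemma fps1_scalerA a b f :
  fps1_scale a (fps1_scale b f) = fps1_scale (a * b) f.
Proof. by apply: fps1P => i /=; rewrite mulrA. Qed.

Lemma fps1_scale1r : left_id 1 fps1_scale.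
Proof. by move=> f; apply: fps1P => i /=; rewrite mul1r. Qed.

Lemma fps1_scalerDr : right_distributive fps1_scale +%R.
Proof. by move=> a f g; apply: fps1P => i /=; rewrite mulrDr. Qed.

Lemma fps1_scalerDl f : {morph fps1_scale^~ f : a b / a + b}.
Proof. by move=> a b; apply: fps1P => i /=; rewrite mulrDl. Qed.

HB.instance Definition _ := GRing.Zmodule_isLmodule.Build K (fps1 K)
  fps1_scalerA fps1_scale1r fps1_scalerDr fps1_scalerDl.

Lemma fps1_scalerAl (c : K) (f g : fps1 K) : c *: (f * g) = (c *: f) * g.
Proof.
apply: fps1P => i /=; rewrite mulr_sumr; apply: eq_bigr => a _.
by rewrite mulrA.
Qed.

HB.instance Definition _ :=
  GRing.Lmodule_isLalgebra.Build K (fps1 K) fps1_scalerAl.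
HB.instance Definition _ := GRing.Lalgebra_isComAlgebra.Build K (fps1 K).

End Fps1Ring.

Section Fps1Ord.
Variable K : fieldType.
Implicit Types f g h : fps1 K.

Definition fpsT : fps1 K := FPS1 (fun i => (i == 1%N)%:R).

Definition ordge n f := forall i, (i < n)%N -> f i = 0.
Definition ordn f n := ordge n f /\ f n != 0.

Lemma coef1D f g i : (f + g) i = f i + g i. Proof. by []. Qed.

Lemma coefTM f i : (fpsT * f) i = if i is j.+1 then f j else 0.
Proof.
rewrite [LHS]/=; case: i => [|i]; first by rewrite big_ord1 mul0r.
rewrite !big_ord_recl /= mul0r add0r mul1r subSS subn0 big1 ?addr0 // => a _.
by rewrite mul0r.
Qed.

Lemma coef1_eq0 f : (forall i, f i = 0) -> f = 0.
Proof. by move=> f0; apply: fps1P => i; rewrite f0. Qed.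

(** Together with [ordge_all], this reduces an identity between morphisms or
derivations to constants and to multiplication by t. *)
Lemma fps1_recl f : f = (f 0%N)%:A + fpsT * FPS1 (fun i => f i.+1).
Proof.
apply: fps1P => i; rewrite coef1D coefTM.
by case: i => [|i] /=; rewrite ?mulr1 ?addr0 // mulr0 add0r.
Qed.

Lemma ordgeD n f g : ordge n f -> ordge n g -> ordge n (f + g).
Proof. by move=> hf hg i lt_in /=; rewrite hf ?hg ?addr0. Qed.

Lemma ordgeM n m f g : ordge n f -> ordge m g -> ordge (n + m) (f * g).
Proof.
move=> hf hg i lt_i; rewrite /= big1 // => -[a /= le_ai] _.
have [lt_an|le_na] := ltnP a n; first by rewrite hf ?mul0r.
by rewrite hg ?mulr0 // ltn_subLR // (leq_trans lt_i) // leq_add2r.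
Qed.

Lemma ordge_le n m f : (m <= n)%N -> ordge n f -> ordge m f.
Proof. by move=> le_mn hf i lt_im; apply: hf; apply: leq_trans le_mn. Qed.

Lemma ordge_all f : (forall n, ordge n f) -> f = 0.
Proof. by move=> h; apply: coef1_eq0 => i; apply: (h i.+1). Qed.

Lemma ordgeMl n f g : ordge n f -> ordge n (g * f).
Proof. by move=> hf; apply: (@ordgeM 0 n). Qed.

Lemma ordnM n m f g : ordn f n -> ordn g m -> ordn (f * g) (n + m).
Proof.
move=> [hf f0] [hg g0]; split; first exact: ordgeM.
have lt_n : (n < (n + m).+1)%N by rewrite ltnS leq_addr.
rewrite /= (bigD1 (Ordinal lt_n)) //= addKn big1 ?addr0 ?mulf_neq0 //.
move=> [a /= le_a] /negPf; rewrite -val_eqE /= => /negbT ne_an.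
have [lt_an|le_na] := ltnP a n; first by rewrite hf ?mul0r.
rewrite hg ?mulr0 // ltn_subLR // ltn_add2r ltn_neqAle le_na andbT.
by rewrite eq_sym.
Qed.

Lemma ordnX n f k : ordn f n -> ordn (f ^+ k) (n * k).
Proof.
move=> hf; elim: k => [|k IH].
  by rewrite muln0; split=> //=; rewrite oner_eq0.
by rewrite exprS mulnS; apply: ordnM.
Qed.

Lemma ordnTX n : ordn (fpsT ^+ n) n.
Proof.
by rewrite -{2}[n]mul1n; apply: ordnX; split=> [[]|] //=; rewrite oner_neq0.
Qed.

Lemma ordn_neq0 f n : ordn f n -> f != 0.
Proof. by case=> _; apply: contraNneq => ->. Qed.

Lemma ordn_ex f : f != 0 -> exists n, ordn f n.
Proof.
move=> f0; have ex : exists i, f i != 0.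
  apply: contrapT => /forallNP h; move/eqP: f0; apply; apply: coef1_eq0 => i.
  by apply/eqP; apply: contrapT => /negP /h.
case: (ex_minnP ex) => n fn min_n; exists n; split=> // i lt_in.
by apply: contraTeq lt_in => /min_n; rewrite -leqNgt.
Qed.

Lemma ordge_ordn f n m : ordge m f -> ordn f n -> (m <= n)%N.
Proof.
by move=> hf [_ fn]; rewrite leqNgt; apply: contraNN fn => /hf ->.
Qed.

Lemma ordn_uniq f n m : ordn f n -> ordn f m -> n = m.
Proof.
move=> hn hm; apply/eqP; rewrite eqn_leq.
by rewrite (ordge_ordn _ hm) ?(ordge_ordn _ hn) //; [case: hm | case: hn].
Qed.

(** Truncating a series far enough does not change its order. *)
Lemma ordn_congr f g n : ordn f n -> ordge n.+1 g -> ordn (f + g) n.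
Proof.
move=> [hf fn] hg; split; last by rewrite /= hg // addr0.
by apply: ordgeD => //; apply: ordge_le hg.
Qed.

Lemma fps1_mulf_eq0 f g : f * g = 0 -> f = 0 \/ g = 0.
Proof.
move=> fg0; have [->|/ordn_ex[n hf]] := eqVneq f 0; first by left.
have [->|/ordn_ex[m hg]] := eqVneq g 0; first by right.
by have := ordn_neq0 (ordnM hf hg); rewrite fg0 eqxx.
Qed.

Lemma fps1_expf_eq0 f k : f ^+ k = 0 -> f = 0.
Proof.
elim: k => [/eqP|k IH]; first by rewrite oner_eq0.
by rewrite exprS => /fps1_mulf_eq0 [].
Qed.

Definition deriv1 f : fps1 K := FPS1 (fun i => f i.+1 *+ i.+1).

Lemma deriv1D f g : deriv1 (f + g) = deriv1 f + deriv1 g.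
Proof. by apply: fps1P => i /=; rewrite mulrnDl. Qed.

Lemma deriv1Z c f : deriv1 (c *: f) = c *: deriv1 f.
Proof. by apply: fps1P => i /=; rewrite mulrnAr. Qed.

Lemma deriv10 : deriv1 0 = 0.
Proof. by apply: fps1P => i /=; rewrite mul0rn. Qed.

Lemma deriv11 : deriv1 1 = 0.
Proof. by apply: fps1P => i /=; rewrite mul0rn. Qed.

Lemma deriv1TM f : deriv1 (fpsT * f) = f + fpsT * deriv1 f.
Proof.
apply: fps1P => i; rewrite [LHS]/(_ *+ _) coefTM.
rewrite coef1D coefTM.
by case: i => [|i] /=; rewrite ?addr0 // mulrS.
Qed.

(** The defect of the Leibniz rule is additive in f, vanishes on constants and
commutes with multiplication by t, so it is divisible by every power of t. *)
Lemma deriv1M f g : deriv1 (f * g) = deriv1 f * g + f * deriv1 g.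
Proof.
pose E f := deriv1 (f * g) - (deriv1 f * g + f * deriv1 g).
have ED u v : E (u + v) = E u + E v.
  by rewrite /E mulrDl !deriv1D !mulrDl [X in _ - X]addrACA opprD addrACA.
have EC c : E c%:A = 0.
  by rewrite /E !mulr_algl !deriv1Z deriv11 scaler0 mul0r add0r subrr.
have ET u : E (fpsT * u) = fpsT * E u.
  rewrite /E -mulrA !deriv1TM mulrDl -!mulrA -[X in _ - X]addrA -mulrDr.
  rewrite opprD addrACA.
  by rewrite subrr add0r mulrBr.
apply/eqP; rewrite -subr_eq0 -/(E f); apply/eqP/ordge_all => n.
elim: n f => [//|n IH] f; rewrite [f]fps1_recl ED EC add0r ET.
by rewrite -add1n; apply: ordgeM => // -[].
Qed.

End Fps1Ord.

(** * Order, units and divisibility in K[[x,y]] *)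

Section Fps2.
Variable K : fieldType.
Implicit Types f g h : fps2 K.

Definition fpsX : fps2 K := FPS2 (fun i j => ((i == 1) && (j == 0))%N%:R).
Definition fpsY : fps2 K := FPS2 (fun i j => ((i == 0) && (j == 1))%N%:R).

Lemma coef2D f g i j : (f + g) i j = f i j + g i j. Proof. by []. Qed.
Lemma coef2N f i j : (- f) i j = - f i j. Proof. by []. Qed.
Lemma coef2Z c f i j : (c *: f) i j = c * f i j. Proof. by []. Qed.
Lemma coef21 i j : (1 : fps2 K) i j = ((i == 0%N) && (j == 0%N))%:R.
Proof. by []. Qed.
Lemma coef2M f g i j : (f * g) i j =
  \sum_(a < i.+1) \sum_(b < j.+1) f a b * g (i - a)%N (j - b)%N.
Proof. by []. Qed.

Lemma coef2XM f i j : (fpsX * f) i j = if i is i'.+1 then f i' j else 0.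
Proof.
rewrite coef2M; case: i => [|i].
  by rewrite big_ord1 big1 // => b _; rewrite /= mul0r.
rewrite big_ord_recl big1 ?add0r => [|b _]; last by rewrite /= mul0r.
rewrite big_ord_recl [X in _ + X]big1 ?addr0 => [|a _]; last first.
  by rewrite big1 // => b _; rewrite /= mul0r.
rewrite big_ord_recl big1 ?addr0 => [|b _]; last by rewrite /= mul0r.
by rewrite /= mul1r subSS !subn0.
Qed.

Lemma coef2YM f i j : (fpsY * f) i j = if j is j'.+1 then f i j' else 0.
Proof.
rewrite coef2M big_ord_recl [X in _ + X]big1 ?addr0 => [|a _]; last first.
  by rewrite big1 // => b _; rewrite /= mul0r.
case: j => [|j]; first by rewrite big_ord1 /= mul0r.
rewrite big_ord_recl /= mul0r add0r big_ord_recl /= mul1r subSS !subn0.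
by rewrite big1 ?addr0 // => b _; rewrite /= mul0r.
Qed.

(** The split that drives all inductions on the order below: what vanishes on
constants and is linear over x and y vanishes to every order. *)
Lemma fps2_recl f : f = (f 0 0)%N%:A + fpsX * FPS2 (fun i j => f i.+1 j) +
  fpsY * FPS2 (fun i j => if i is 0%N then f 0%N j.+1 else 0).
Proof.
apply: fps2P => i j; rewrite !coef2D coef2XM coef2YM coef2Z coef21.
by case: i j => [|i] [|j] //=; rewrite ?mulr1 ?mulr0 ?add0r ?addr0.
Qed.

Lemma fps2_recX f : (forall j, f 0%N j = 0) ->
  f = fpsX * FPS2 (fun i j => f i.+1 j).
Proof. by move=> f0; apply: fps2P => -[|i] j; rewrite coef2XM. Qed.

Lemma fps2_recXn n f : (forall i j, (i < n)%N -> f i j = 0) ->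
  f = fpsX ^+ n * FPS2 (fun i j => f (i + n)%N j).
Proof.
elim: n f => [|n IH] f f0.
  by rewrite expr0 mul1r; apply: fps2P => i j /=; rewrite addn0.
have e : f = _ := fps2_recX (fun j => f0 0%N j isT).
rewrite [LHS]e [FPS2 _ in LHS]IH => [|i j lt_in]; last exact: f0.
by rewrite mulrA -exprS; congr (_ * _); apply: fps2P => i j /=; rewrite addnS.
Qed.

Lemma fps2_recYn n f : (forall i j, (j < n)%N -> f i j = 0) ->
  f = fpsY ^+ n * FPS2 (fun i j => f i (j + n)%N).
Proof.
elim: n f => [|n IH] f f0.
  by rewrite expr0 mul1r; apply: fps2P => i j /=; rewrite addn0.
have e : f = fpsY * FPS2 (fun i j => f i j.+1).
  by apply: fps2P => i [|j]; rewrite coef2YM // f0.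
rewrite [LHS]e [FPS2 _ in LHS]IH => [|i j lt_in]; last exact: f0.
by rewrite mulrA -exprS; congr (_ * _); apply: fps2P => i j /=; rewrite addnS.
Qed.

Definition ge2 n f := forall i j, (i + j < n)%N -> f i j = 0.

Lemma ge2D n f g : ge2 n f -> ge2 n g -> ge2 n (f + g).
Proof. by move=> hf hg i j lt_n; rewrite coef2D hf ?hg ?addr0. Qed.

Lemma ge2B n f g : ge2 n f -> ge2 n g -> ge2 n (f - g).
Proof. by move=> hf hg i j lt_n; rewrite coef2D coef2N hf ?hg ?subr0. Qed.

Lemma ge2Z n c f : ge2 n f -> ge2 n (c *: f).
Proof. by move=> hf i j lt_n; rewrite coef2Z hf ?mulr0. Qed.

Lemma ge2_sum n m (F : 'I_m -> fps2 K) :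
  (forall i, ge2 n (F i)) -> ge2 n (\sum_(i < m) F i).
Proof. by move=> wF; apply: (big_ind (ge2 n)) => //; exact: ge2D. Qed.

Lemma ge2M n m f g : ge2 n f -> ge2 m g -> ge2 (n + m) (f * g).
Proof.
move=> hf hg i j lt_n; rewrite coef2M big1 // => -[a /= le_a] _.
rewrite big1 // => -[b /= le_b] _.
have [lt_n'|le_n'] := ltnP (a + b)%N n; first by rewrite hf ?mul0r.
by rewrite hg ?mulr0 //; lia.
Qed.

Lemma ge2Ml n f g : ge2 n f -> ge2 n (g * f).
Proof. by move=> hf; apply: (@ge2M 0 n). Qed.

Lemma ge2_le n m f : (m <= n)%N -> ge2 n f -> ge2 m f.
Proof. by move=> le_mn hf i j lt_im; apply: hf; apply: leq_trans le_mn. Qed.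

Lemma ge2_all f : (forall n, ge2 n f) -> f = 0.
Proof. by move=> h; apply: fps2P => i j; apply: (h (i + j).+1). Qed.

Lemma ge2X f k : ge2 1 f -> ge2 k (f ^+ k).
Proof.
by move=> hf; elim: k => // k IH; rewrite exprS -add1n; apply: ge2M.
Qed.

Lemma ge2_1 f : f 0%N 0%N = 0 -> ge2 1 f.
Proof. by move=> f0 [|i] [|j]. Qed.

(** Among the monomials of lowest total degree, take in each factor the one of
least degree in y: no other pair contributes to their product. *)
Lemma has_orderM n m f g :
  has_order f n -> has_order g m -> has_order (f * g) (n + m).
Proof.
move=> [hf exf] [hg exg]; split; first exact: ge2M.
have low h k : (exists i j, (i + j)%N = k /\ h i j != 0) -> exists2 j,
    (j <= k)%N && (h (k - j)%N j != 0) &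
    forall j', (j' <= k)%N -> h (k - j')%N j' != 0 -> (j <= j')%N.
  case=> i0 [j0 [e0 h0]].
  have ex : exists j, (j <= k)%N && (h (k - j)%N j != 0).
    by exists j0; rewrite -e0 leq_addl addnK.
  case: (ex_minnP ex) => j hj min_j; exists j => // j' le_j' h'.
  by apply: min_j; rewrite le_j'.
have [j1 /andP[le1 f1] min1] := low _ _ exf.
have [j2 /andP[le2 g2] min2] := low _ _ exg.
exists (n - j1 + (m - j2))%N, (j1 + j2)%N; split; first lia.
have vanish a b : (a <= n - j1 + (m - j2))%N -> (b <= j1 + j2)%N ->
    ~ (a = n - j1 /\ b = j1)%N ->
    f a b * g (n - j1 + (m - j2) - a)%N (j1 + j2 - b)%N = 0.
  move=> le_a le_b ne; apply/eqP; rewrite mulf_eq0; apply/norP => -[fab gab].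
  have na : (n <= a + b)%N by rewrite leqNgt; apply: contraNN fab => /hf ->.
  have ma : (m <= n - j1 + (m - j2) - a + (j1 + j2 - b))%N.
    by rewrite leqNgt; apply: contraNN gab => /hg ->.
  have ea : (a = n - b)%N by lia.
  have eb : (n - j1 + (m - j2) - a = m - (j1 + j2 - b))%N by lia.
  rewrite eb in gab; rewrite ea in fab.
  have m1 : (j1 <= b)%N by apply: min1; [lia|exact: fab].
  have m2 : (j2 <= j1 + j2 - b)%N by apply: min2; [lia|exact: gab].
  by apply: ne; lia.
rewrite coef2M.
have lt_i : (n - j1 < (n - j1 + (m - j2)).+1)%N by lia.
have lt_j : (j1 < (j1 + j2).+1)%N by lia.
rewrite (bigD1 (Ordinal lt_i)) //= [X in _ + X]big1 ?addr0; last first.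
  move=> [a /= le_a] ne; rewrite big1 // => -[b /= le_b] _.
  by apply: vanish => // -[ea _]; move/eqP: ne; apply; apply: val_inj.
rewrite (bigD1 (Ordinal lt_j)) //= [X in _ + X]big1 ?addr0; last first.
  move=> [b /= le_b] ne; apply: vanish; [lia|exact: le_b|].
  by case=> [_ eb]; move/eqP: ne; apply; apply: val_inj.
by rewrite !addKn mulf_neq0.
Qed.

Lemma has_order_ex f : f <> 0 -> exists n, has_order f n.
Proof.
move=> f0; have ex : exists n, `[< exists i j, (i + j)%N = n /\ f i j != 0 >].
  apply: contrapT => h; apply: f0; apply: fps2P => i j; apply/eqP.
  apply: contrapT => /negP hij; apply: h; exists (i + j)%N.
  by apply/asboolP; exists i, j.
case: (ex_minnP ex) => n /asboolP hn min_n; exists n; split=> // i j lt_n.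
apply/eqP; apply: contrapT => /negP hij.
suff : (n <= i + j)%N by lia.
by apply: min_n; apply/asboolP; exists i, j.
Qed.

Lemma has_order_neq0 f n : has_order f n -> f <> 0.
Proof. by case=> _ [i [j [_ /eqP fij]]] f0; rewrite f0 in fij. Qed.

Lemma has_order_uniq f n m : has_order f n -> has_order f m -> n = m.
Proof.
move=> [hn [i [j [en /eqP fn]]]] [hm [i' [j' [em /eqP fm]]]].
case: (ltngtP n m) => // lt.
  by case: fn; apply: hm; rewrite en.
by case: fm; apply: hn; rewrite em.
Qed.

Lemma fps2_mulf_eq0 f g : f * g = 0 -> f = 0 \/ g = 0.
Proof.
move=> fg0; have [->|/eqP/has_order_ex[n hf]] := eqVneq f 0; first by left.
have [->|/eqP/has_order_ex[m hg]] := eqVneq g 0; first by right.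
by have /has_order_neq0 := has_orderM hf hg; rewrite fg0.
Qed.

Lemma fps2_mulfI f g h : f <> 0 -> f * g = f * h -> g = h.
Proof.
move=> f0 /eqP; rewrite -subr_eq0 -mulrBr => /eqP /fps2_mulf_eq0 [//|/eqP].
by rewrite subr_eq0 => /eqP.
Qed.

(** Agreement in d-degree less than n.  The weight d is i + j for the topology
of the maximal ideal, and i for the x-adic one. *)
Definition agree2 (d : nat -> nat -> nat) n f g :=
  forall i j, (d i j < n)%N -> f i j = g i j.

(** Contraction principle: the d-degree part of the fixed point is already that
of a finite iterate of F from 0. *)
Lemma fps2_fixpoint (d : nat -> nat -> nat) (F : fps2 K -> fps2 K) :
  (forall n f g, agree2 d n f g -> agree2 d n.+1 (F f) (F g)) ->
  exists f, F f = f.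
Proof.
move=> Fc; pose u n := iter n F 0.
have uS n : agree2 d n (u n) (u n.+1).
  by elim: n => [|n IH] //; apply: Fc.
have uD n k : agree2 d n (u n) (u (n + k)%N).
  elim: k => [|k IH] i j lt_n; first by rewrite addn0.
  by rewrite IH // addnS uS // (leq_trans lt_n) // leq_addr.
pose f := FPS2 (fun i j => u (d i j).+1 i j).
have fu n : agree2 d n f (u n).
  move=> i j lt_n; have := @uD (d i j).+1 (n - (d i j).+1)%N i j (ltnSn _).
  by rewrite subnKC.
exists f; apply: fps2P => i j.
by rewrite [RHS](fu (d i j).+1) //=; apply: Fc (fu _) _ _ _.
Qed.

(** An inverse of f = c - z, with z of positive order, is a fixed point of
g |-> c^-1 (1 + z g). *)
Lemma fps2_unit00 f : f 0%N 0%N != 0 -> exists g, f * g = 1.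
Proof.
move=> f0; pose c := f 0%N 0%N; pose z := c%:A - f.
have z1 : ge2 1 z by apply: ge2_1; rewrite coef2D coef2N coef2Z mulr1 subrr.
have [n u v uv|g eg] := @fps2_fixpoint addn (fun g => c^-1 *: (1 + z * g)).
  move=> i j lt_n; apply/eqP; rewrite -subr_eq0; apply/eqP.
  rewrite -coef2N -coef2D -scalerBr opprD addrACA subrr add0r -mulrBr.
  apply: (@ge2Z n.+1) => //; rewrite -add1n; apply: ge2M => // i' j' lt'.
  by rewrite coef2D coef2N uv ?subrr.
exists g; have /(congr1 (fun u => c *: u)) := eg.
rewrite scalerA divff // scale1r mulrBl mulr_algl => /eqP.
by rewrite addrCA -subr_eq0 addrAC subrr add0r subr_eq0 => /eqP <-.
Qed.

Lemma fps2_unitE f : (f \is a GRing.unit) = (f 0%N 0%N != 0).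
Proof.
apply/idP/idP => [|/fps2_unit00 [g fg1]]; last first.
  by apply/unitrPr; exists g.
move=> /divrr /(congr1 (fun u : fps2 K => u 0%N 0%N)).
rewrite coef2M !big_ord1 subn0; apply: contra_eqN => /eqP ->.
by rewrite mul0r eq_sym oner_eq0.
Qed.

Lemma has_order0_unit f : has_order f 0 -> f \is a GRing.unit.
Proof.
case=> _ [i [j [e fij]]]; rewrite fps2_unitE.
have [ei ej] : (i = 0 /\ j = 0)%N by lia.
by rewrite ei ej in fij.
Qed.

Lemma nonunit_order f : f <> 0 -> f \isn't a GRing.unit ->
  exists2 n, has_order f n & (0 < n)%N.
Proof.
move=> /has_order_ex[[|n] fn] /negP fu; last by exists n.+1.
by case: fu; apply: has_order0_unit.
Qed.

End Fps2.

(** * Weierstrass division *)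

Section Weierstrass.
Variable K : fieldType.
Implicit Types f g h : fps2 K.

Let agreex := @agree2 K (fun i _ => i).

Lemma agreexM n f g u : agreex n f g -> agreex n (f * u) (g * u).
Proof.
move=> fg i j lt_i; rewrite !coef2M; apply: eq_bigr => -[a /= le_a] _.
by apply: eq_bigr => b _; rewrite fg //; lia.
Qed.

(** Write h = al + y^N tau(h), where al collects the degrees in y below N and
tau drops them; tau(h) is a unit b^-1, and x divides al.  The unknown
Q = q tau(h) has to satisfy Q = tau f - tau (Q b al), whose right-hand side is
an x-adic contraction. *)
Lemma weierstrass_division h N :
  (forall j, (j < N)%N -> h 0%N j = 0) -> h 0%N N != 0 ->
  forall f, exists q r, f = q * h + r /\ forall i j, (N <= j)%N -> r i j = 0.
Proof.
move=> h0 hN f.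
pose tau (u : fps2 K) : fps2 K := FPS2 (fun i j => u i (j + N)%N).
have tauE u i j : tau u i j = u i (j + N)%N by [].
have tauD u v : tau (u + v) = tau u + tau v by apply: fps2P.
have tauN u : tau (- u) = - tau u by apply: fps2P.
have tauYN u : tau (fpsY K ^+ N * u) = u.
  apply: fps2P => i j; change ((fpsY K ^+ N * u) i (j + N)%N = u i j).
  elim: (N) u => [|k IH] u.
    by rewrite expr0 mul1r addn0.
  by rewrite exprS -mulrA addnS coef2YM IH.
pose al := FPS2 (fun i j => if (j < N)%N then h i j else 0) : fps2 K.
pose al' := FPS2 (fun i j => al i.+1 j) : fps2 K.
have alE : al = fpsX K * al'.
  by apply: fps2_recX => j /=; case: ifP => // /h0.
have hE : h = al + fpsY K ^+ N * tau h.
  have -> : h = al + FPS2 (fun i j => if (N <= j)%N then h i j else 0).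
    apply: fps2P => i j; rewrite coef2D /=.
    by case: ltnP; rewrite ?addr0 ?add0r.
  congr (_ + _); rewrite [LHS](@fps2_recYn _ N) => [|i j]; last first.
    by move=> lt_j /=; rewrite leqNgt lt_j.
  congr (_ * _); apply: fps2P => i j /=; rewrite leq_addl.
  by rewrite ltnNge leq_addl add0r.
have [b hb] : exists b, tau h * b = 1 by apply: fps2_unit00; rewrite /= add0n.
have [n u v uv|Q eQ] :=
    @fps2_fixpoint K (fun i _ => i) (fun Q => tau f - tau (Q * b * al)).
  have {}uv : agreex n (u * (b * al')) (v * (b * al')) by apply: agreexM.
  move=> i j lt_i; rewrite !coef2D !coef2N !tauE; congr (_ - _).
  rewrite alE ![_ * (fpsX K * _)]mulrCA -!mulrA.
  by rewrite !coef2XM; case: i lt_i => // i lt_i; apply: uv.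
exists (Q * b), (f - Q * b * h); split; first by rewrite addrC subrK.
suff tau0 : tau (f - Q * b * h) = 0.
  move=> i j le_j; have /(congr1 (fun u : fps2 K => u i (j - N)%N)) := tau0.
  by rewrite tauE subnK.
rewrite tauD tauN {1}hE mulrDr tauD [_ * (_ * tau h)]mulrCA tauYN.
by rewrite -[_ * tau h]mulrA [b * _]mulrC hb mulr1 opprD addrA eQ subrr.
Qed.

End Weierstrass.

(** * Substitution of power series *)

Section Morphisms.
Variable K : fieldType.
Implicit Types f g h : fps2 K.

Definition swap2 f : fps2 K := FPS2 (fun i j => f j i).

Lemma swap2_is_zmod_morphism : zmod_morphism swap2.
Proof. by move=> f g; apply: fps2P. Qed.

Lemma swap2_is_monoid_morphism : monoid_morphism swap2.
Proof.
split=> [|f g]; first by apply: fps2P => i j; rewrite [LHS]/= andbC.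
apply: fps2P => i j; rewrite coef2M; exact: exchange_big.
Qed.

Lemma swap2_is_scalable : scalable swap2.
Proof. by move=> c f; apply: fps2P. Qed.

HB.instance Definition _ := GRing.isZmodMorphism.Build _ _ swap2
  swap2_is_zmod_morphism.
HB.instance Definition _ := GRing.isMonoidMorphism.Build _ _ swap2
  swap2_is_monoid_morphism.
HB.instance Definition _ := GRing.isScalable.Build _ _ _ _ swap2
  swap2_is_scalable.

(** Restriction to the axis y = 0. *)
Definition axisX f : fps1 K := FPS1 (fun i => f i 0%N).

Lemma axisX_is_zmod_morphism : zmod_morphism axisX.
Proof. by move=> f g; apply: fps1P. Qed.

Lemma axisX_is_monoid_morphism : monoid_morphism axisX.
Proof.
split=> [|f g]; first by apply: fps1P => i /=; rewrite andbT.
apply: fps1P => i; rewrite [LHS]coef2M; apply: eq_bigr => a _.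
by rewrite big_ord1.
Qed.

Lemma axisX_is_scalable : scalable axisX.
Proof. by move=> c f; apply: fps1P. Qed.

HB.instance Definition _ := GRing.isZmodMorphism.Build _ _ axisX
  axisX_is_zmod_morphism.
HB.instance Definition _ := GRing.isMonoidMorphism.Build _ _ axisX
  axisX_is_monoid_morphism.
HB.instance Definition _ := GRing.isScalable.Build _ _ _ _ axisX
  axisX_is_scalable.

Definition onX (f : fps1 K) : fps2 K :=
  FPS2 (fun i j => if j == 0%N then f i else 0).

Lemma axisX_onX (f : fps1 K) : axisX (onX f) = f. Proof. exact: fps1P. Qed.

Lemma fps1_unit0 (f : fps1 K) : f 0%N != 0 -> exists g : fps1 K, f * g = 1.
Proof.
move=> f0; have [//|g fg1] := @fps2_unit00 _ (onX f).
exists (axisX g); apply/eqP.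
by rewrite -{1}[f]axisX_onX -rmorphM fg1 rmorph1.
Qed.

Section Subst.
Variables a b : fps2 K.
Hypotheses (a1 : ge2 1 a) (b1 : ge2 1 b).

Let e := horner_eval a \o map_poly (horner_alg b).

Let eB P Q : e (P - Q) = e P - e Q. Proof. by rewrite /e rmorphB. Qed.
Let eM P Q : e (P * Q) = e P * e Q. Proof. by rewrite /e rmorphM. Qed.
Let e1 : e 1 = 1. Proof. by rewrite /e rmorph1. Qed.

Let eC c : e c%:P%:P = c%:A.
Proof. by rewrite /e /= map_polyC /horner_eval hornerC /= horner_algC. Qed.
Let eX : e 'X = a.
Proof. by rewrite /e /= map_polyX /horner_eval hornerX. Qed.
Let eY : e 'X%:P = b.
Proof. by rewrite /e /= map_polyC /horner_eval hornerC /= horner_algX. Qed.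

Definition agreep n f (P : {poly {poly K}}) :=
  forall i j, (i < n)%N -> (j < n)%N -> P`_i`_j = f i j.

Let trunc n f : {poly {poly K}} := \poly_(i < n) \poly_(j < n) f i j.

Let agreep_trunc n f : agreep n f (trunc n f).
Proof. by move=> i j lt_i lt_j; rewrite !(coef_poly, lt_i, lt_j). Qed.

Let agreepM n f g P Q :
  agreep n f P -> agreep n g Q -> agreep n (f * g) (P * Q).
Proof.
move=> Pf Qg i j lt_i lt_j; rewrite coefM coef_sum coef2M.
apply: eq_bigr => -[c /= le_c] _; rewrite coefM.
by apply: eq_bigr => -[d /= le_d] _; rewrite Pf ?Qg //; lia.
Qed.

(** A monomial with one exponent at least n is sent to degree at least n. *)
Let ge2_e n (P : {poly {poly K}}) :
  (forall i j, (i < n)%N -> (j < n)%N -> P`_i`_j = 0) -> ge2 n (e P).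
Proof.
move=> P0; rewrite /e /= /horner_eval horner_coef; apply: ge2_sum => i.
rewrite coef_map /=; have [lt_i|le_i] := ltnP i n; last first.
  by apply/ge2Ml/(ge2_le le_i)/ge2X.
rewrite mulrC; apply: ge2Ml; rewrite /horner_alg /= /horner_morph.
rewrite horner_coef; apply: ge2_sum => j; rewrite coef_map /= mulr_algl.
have [lt_j|le_j] := ltnP j n; first by rewrite P0 // scale0r.
by apply/ge2Z/(ge2_le le_j)/ge2X.
Qed.

Let subst f : fps2 K := FPS2 (fun i j => e (trunc (i + j).+1 f) i j).

Let substE n f P : agreep n f P -> ge2 n (subst f - e P).
Proof.
move=> Pf i j lt_n; rewrite coef2D coef2N /=.
have h := @ge2_e (i + j).+1 (trunc (i + j).+1 f - P).
rewrite eB in h; apply: (h _ i j) => // i' j' lt_i lt_j.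
by rewrite !coefB agreep_trunc // Pf ?subrr //; lia.
Qed.

Let substP f g : (forall n, exists2 P, agreep n f P & ge2 n (g - e P)) ->
  subst f = g.
Proof.
move=> h; apply/eqP; rewrite -subr_eq0; apply/eqP/ge2_all => n.
have [P Pf gP] := h n.
rewrite -[_ - g](subrKA (e P)) -[e P - g]opprB.
by apply: ge2B => //; exact: substE.
Qed.

(** Coefficients of degree below n of the composite only depend on the
truncation of f, so multiplicativity is inherited from the evaluation e of
polynomials at (a, b). *)
Lemma subst_ex : exists phi : {lrmorphism fps2 K -> fps2 K},
  phi (fpsX K) = a /\ phi (fpsY K) = b.
Proof.
have sB : zmod_morphism subst.
  move=> f g; apply: substP => n; exists (trunc n f - trunc n g).
    by move=> i j lt_i lt_j; rewrite !coefB !agreep_trunc.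
  have -> : subst f - subst g - e (trunc n f - trunc n g) =
    (subst f - e (trunc n f)) - (subst g - e (trunc n g)).
    by rewrite eB !opprB [e _ - e _]addrC addrACA [- _ + _]addrC.
  by apply: ge2B; apply/substE/agreep_trunc.
have s1 : subst 1 = 1.
  apply: substP => n; exists 1; last by rewrite e1 subrr.
  by move=> i j _ _; rewrite coef1; case: i => [|i] /=; rewrite ?coef1 ?coef0.
have sM : {morph subst : f g / f * g}.
  move=> f g; apply: substP => n; exists (trunc n f * trunc n g).
    by apply: agreepM; apply: agreep_trunc.
  rewrite eM.
  have -> : subst f * subst g - e (trunc n f) * e (trunc n g) =
    (subst f - e (trunc n f)) * subst g +
    e (trunc n f) * (subst g - e (trunc n g)).
    by rewrite mulrBl mulrBr addrA subrK.
  by apply: ge2D; [rewrite mulrC|]; apply/ge2Ml/substE/agreep_trunc.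
have sZ : scalable subst.
  move=> c f; apply: substP => n; exists (c%:P%:P * trunc n f).
    by move=> i j lt_i lt_j; rewrite !coefCM agreep_trunc.
  by rewrite eM eC mulr_algl -scalerBr; apply/ge2Z/substE/agreep_trunc.
pose phi : {lrmorphism fps2 K -> fps2 K} := HB.pack subst
  (GRing.isZmodMorphism.Build _ _ subst sB)
  (GRing.isMonoidMorphism.Build _ _ subst (s1, sM))
  (GRing.isScalable.Build _ _ _ _ subst sZ).
exists phi; split; apply: substP => n.
  exists 'X; last by rewrite eX subrr.
  by move=> i j _ _; rewrite coefX /=; case: (i == _); rewrite ?coef1 ?coef0.
exists 'X%:P.
  by move=> i j _ _; rewrite coefC /=; case: (i == _); rewrite ?coefX ?coef0.
by rewrite eY subrr.
Qed.

End Subst.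
End Morphisms.

(** * Arcs and blowing up *)

Section Arcs.
Variable K : fieldType.
Implicit Types (f g h : fps2 K) (phi psi : {lrmorphism fps2 K -> fps1 K}).

Local Notation X := (fpsX K).
Local Notation Y := (fpsY K).
Local Notation T := (fpsT K).

Lemma ge2_fpsX : ge2 1 X. Proof. exact: ge2_1. Qed.

(** Morphisms are automatically local: if phi g had constant term c <> 0 with
g(0,0) = 0, the unit g - c would be sent to a non-unit.  Continuity follows, see
[arc_ext]. *)
Lemma arc_coef0 phi f : phi f 0%N = f 0%N 0%N.
Proof.
have vanish g : g 0%N 0%N = 0 -> phi g 0%N = 0.
  move=> g0; apply: contrapT => /eqP c0; set c := phi g 0%N in c0.
  have [|u] := @fps2_unit00 _ (g - c%:A).
    by rewrite coef2D coef2N coef2Z coef21 g0 sub0r oppr_eq0 mulr1.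
  move=> /(congr1 phi); rewrite rmorphM rmorphB rmorph1 /= rmorph_alg.
  move/(congr1 (fun u : fps1 K => u 0%N)).
  rewrite /= big_ord1 /= mulr1 -/c subrr mul0r => /eqP.
  by rewrite eq_sym oner_eq0.
have := vanish (f - (f 0%N 0%N)%:A).
rewrite coef2D coef2N coef2Z coef21 mulr1 subrr rmorphB /= rmorph_alg.
by move=> /(_ erefl) /= /eqP; rewrite mulr1 subr_eq0 => /eqP.
Qed.

Lemma arcX_ordge phi : ordge 1 (phi X).
Proof. by case=> // _; rewrite arc_coef0. Qed.

Lemma arcY_ordge phi : ordge 1 (phi Y).
Proof. by case=> // _; rewrite arc_coef0. Qed.

Lemma arc_ext phi psi : phi X = psi X -> phi Y = psi Y -> phi =1 psi.
Proof.
move=> eX eY f; apply/eqP; rewrite -subr_eq0; apply/eqP/ordge_all => n.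
elim: n f => [//|n IH] f; rewrite [f]fps2_recl.
set u := FPS2 _; set v := FPS2 _.
have -> : phi ((f 0%N 0%N)%:A + X * u + Y * v) -
    psi ((f 0%N 0%N)%:A + X * u + Y * v) =
    phi X * (phi u - psi u) + phi Y * (phi v - psi v).
  rewrite !rmorphD !rmorphM /= !rmorph_alg -eX -eY !mulrBr.
  by rewrite opprD addrACA; congr (_ + _); rewrite opprD addrACA subrr add0r.
by rewrite -add1n; apply: ordgeD; apply: ordgeM => //;
  [apply: arcX_ordge | apply: arcY_ordge].
Qed.

Lemma arc_trivial phi f : phi X = 0 -> phi Y = 0 -> phi f = (f 0%N 0%N)%:A.
Proof.
move=> eX eY; rewrite {1}[f]fps2_recl !rmorphD !rmorphM /= rmorph_alg eX eY.
by rewrite !mul0r !addr0.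
Qed.

Lemma arc_of_ex (b : fps1 K) : b 0%N = 0 ->
  exists phi : {lrmorphism fps2 K -> fps1 K}, phi X = T /\ phi Y = b.
Proof.
move=> b0; have [|phi [eX eY]] := @subst_ex K X (onX b) ge2_fpsX.
  exact: ge2_1.
exists (axisX (K:=K) \o phi); rewrite /= eX eY axisX_onX; split=> //.
by apply: fps1P => i /=; rewrite andbT.
Qed.

(** Restriction to the axis x = 0, that is f |-> f(0,t). *)
Definition axisY : {lrmorphism fps2 K -> fps1 K} :=
  axisX (K:=K) \o swap2 (K:=K).

(** h' is the strict transform of h, of multiplicity m, at the point of slope c
of the exceptional divisor, in the chart (x, y) |-> (x, x (y + c)). *)
Definition blowup (m : nat) (c : K) h h' :=
  exists beta : {lrmorphism fps2 K -> fps2 K},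
  [/\ beta X = X, beta Y = X * (Y + c%:A) & beta h = X ^+ m * h'].

(** Elements of consecutive orders exist exactly when the orders of nonzero
elements of the image generate the group of integers: the arc is then not a
reparametrization of another one by a series of order at least 2. *)
Definition primitive_arc phi :=
  exists g1 g2 n, ordn (phi g1) n.+1 /\ ordn (phi g2) n.

Definition has_arc h := exists2 phi : {lrmorphism fps2 K -> fps1 K},
  phi h = 0 & primitive_arc phi.

(** An explicit expression of membership in the m-th power of the maximal ideal;
the constant terms of the r k are the coefficients of the leading form. *)
Lemma leading_forms m h : ge2 m h -> exists2 r : nat -> fps2 K,
  h = \sum_(k < m.+1) X ^+ (m - k) * Y ^+ k * r k &
  forall k, (k <= m)%N -> r k 0%N 0%N = h (m - k)%N k.
Proof.
elim: m h => [|m IH] h hm.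
  exists (fun=> h); first by rewrite big_ord1 !expr0 !mul1r.
  by case=> // _; rewrite subn0.
have [|r e er] := IH (FPS2 (fun i j => h i.+1 j)).
  by move=> i j /= ?; apply: hm.
pose v := FPS2 (fun i j => if i is 0%N then h 0%N j.+1 else 0) : fps2 K.
have [w ev ew] : exists2 w, v = Y ^+ m * w & w 0%N 0%N = h 0%N m.+1.
  exists (FPS2 (fun i j => v i (j + m)%N)) => //.
  by apply: fps2_recYn => -[|i] j lt_j //=; apply: hm.
exists (fun k => if (k <= m)%N then r k else w).
  rewrite {1}[h]fps2_recl hm // scale0r add0r -/v e ev [RHS]big_ord_recr.
  rewrite [in RHS]/= ltnn subnn expr0 mul1r exprS mulrA; congr (_ + _).
  rewrite mulr_sumr; apply: eq_bigr => -[k /= le_k] _.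
  by rewrite -ltnS le_k !mulrA -exprS subSn.
move=> k; rewrite leq_eqVlt => /orP[/eqP->|]; first by rewrite ltnn subnn.
by rewrite ltnS => le_k; rewrite le_k er //= subSn.
Qed.

Lemma horner_alg_coef0 (b : fps1 K) (q : {poly K}) :
  horner_alg b q 0%N = q.[b 0%N].
Proof.
elim/poly_ind: q => [|q c IH]; first by rewrite rmorph0 horner0.
have -> : horner_alg b (q * 'X + c%:P) = horner_alg b q * b + c%:A.
  by rewrite rmorphD rmorphM /= horner_algX horner_algC.
by rewrite hornerMXaddC -IH coef1D /= big_ord1 mulr1.
Qed.

(** On the exceptional divisor x = 0 the strict transform is the leading form
dehomogenized at x = 1 and translated by c; its order j there is the
multiplicity of the root c. *)
Lemma blowup_ex m h c : has_order h m ->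
    root (\poly_(k < m.+1) h (m - k)%N k) c ->
  exists h' j, [/\ blowup m c h h', (0 < j <= m)%N & ordn (axisY h') j].
Proof.
move=> [hm [i0 [j0 [e0 h0]]]]; set p := \poly_(k < _) _ => pc.
have p0 : p != 0.
  apply: contraNneq h0 => /(congr1 (fun q : {poly K} => q`_j0)).
  by rewrite coef_poly coef0 -e0 ltnS leq_addl addnK => ->.
have [|beta [bX bY]] := @subst_ex K X (X * (Y + c%:A)) ge2_fpsX.
  by rewrite mulrC; apply/ge2Ml/ge2_fpsX.
have [r e er] := leading_forms hm.
pose h' := \sum_(k < m.+1) (Y + c%:A) ^+ k * beta (r k).
have bh : beta h = X ^+ m * h'.
  rewrite e rmorph_sum mulr_sumr; apply: eq_bigr => -[k /= le_k] _.
  by rewrite !rmorphM !rmorphXn /= bX bY exprMn !mulrA -exprD subnK.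
pose t := axisY (Y + c%:A).
have tE : t = T + c%:A.
  by rewrite /t rmorphD /= !rmorph_alg.
have axb f : axisY (beta f) = (f 0%N 0%N)%:A.
  apply: (@arc_trivial (axisY \o beta)); rewrite /= ?bX ?bY ?rmorphM.
    by apply: coef1_eq0.
  by rewrite /= (_ : axisX _ = 0) ?mul0r //; apply: coef1_eq0.
have h'E : axisY h' = horner_alg t p.
  rewrite /h' rmorph_sum /horner_alg /horner_morph (@horner_coef_wide _ m.+1).
    apply: eq_bigr => -[k /= le_k] _.
    rewrite [LHS](_ : _ = t ^+ k * axisY (beta (r k))); last first.
      by rewrite !rmorphM !rmorphXn.
    by rewrite axb mulrC er // coef_map coef_poly le_k.
  by rewrite (leq_trans (size_poly _ _)) // size_poly.
have [j [q]] := multiplicity_XsubC p c; rewrite p0 /= => qc ep.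
exists h', j; split; first by exists beta.
  rewrite lt0n; apply/andP; split.
    by apply: contraNneq qc => jz; move: pc; rewrite ep jz expr0 mulr1.
  have q0 : q != 0 by apply: contraNneq p0 => q0; rewrite ep q0 mul0r.
  have := size_poly m.+1 (fun k => h (m - k)%N k); rewrite -/p ep.
  rewrite size_Mmonic ?monic_exp ?monicXsubC // size_exp_XsubC addnS /=.
  move=> le_q; rewrite -ltnS; apply: leq_trans le_q.
  by rewrite -[X in (X < _)%N]add0n ltn_add2r size_poly_gt0.
suff: ordn (horner_alg t p) j by rewrite -h'E.
rewrite ep rmorphM rmorphXn rmorphB /= horner_algX horner_algC tE addrK.
rewrite -[j]add0n; apply: ordnM; first split=> //.
  rewrite horner_alg_coef0 coef1D /= mulr1 add0r; exact: qc.
exact: ordnTX.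
Qed.

(** Up to high order and a power of x, every series is a polynomial in x and y,
and x^N times a monomial of degree at most N in y comes from the blown-down
ring, since x y is the image of y - c x.  So a primitive arc on the blow-up
stays primitive on the plane. *)
Lemma blowup_approx c (beta : {lrmorphism fps2 K -> fps2 K}) phi :
  beta X = X -> beta Y = X * (Y + c%:A) ->
  forall N g, exists g' rho,
    phi (beta g') = phi X ^+ N * (phi g + rho) /\ ordge N rho.
Proof.
move=> bX bY; elim=> [|N IH] g.
  by exists 1, (1 - phi g); rewrite !rmorph1 expr0 mul1r addrC subrK.
rewrite [g]fps2_recl; set u := FPS2 _; set v := FPS2 _; set a := g 0%N 0%N.
have [u' [ru [eu hu]]] := IH u; have [v' [rv [ev hv]]] := IH v.
exists (a *: X ^+ N.+1 + X ^+ 2 * u' + (Y - c *: X) * v').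
exists (phi X * ru + phi Y * rv); split; last first.
  by rewrite -add1n; apply: ordgeD; apply: ordgeM => //;
    [apply: arcX_ordge | apply: arcY_ordge].
have -> : beta (a *: X ^+ N.+1 + X ^+ 2 * u' + (Y - c *: X) * v') =
    a%:A * X ^+ N.+1 + X ^+ 2 * beta u' + X * Y * beta v'.
  rewrite !rmorphD !rmorphM !rmorphB /= !linearZ /= !rmorphXn /= bX bY.
  by rewrite mulr_algl mulrDr [X * c%:A]mulrC mulr_algl scalerN addrK.
rewrite !rmorphD !rmorphM !rmorphXn /= !rmorph_alg eu ev.
rewrite ?expr2 !exprS.
set x := phi X; set y := phi Y; set xn := x ^+ N; set A := _%:A.
ring.
Qed.

Lemma has_arc_blowup m c h h' j : (0 < j)%N -> ordn (axisY h') j ->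
  blowup m c h h' -> has_arc h' -> has_arc h.
Proof.
move=> j0 hj [beta [bX bY bh]] [phi ph' [g1 [g2 [n [w1 w2]]]]].
have x0 : phi X <> 0.
(* h'(0,y) is y^j times a unit, so phi X = 0 would force phi Y = 0. *)
  move=> x0; have y0 : phi Y = 0.
    pose v := FPS2 (fun i k => if i is 0%N then h' 0%N k else 0) : fps2 K.
    have eh : h' = X * FPS2 (fun i k => h' i.+1 k) + v.
      by apply: fps2P => -[|i] k; rewrite coef2D coef2XM ?add0r ?addr0.
    have ev : v = Y ^+ j * FPS2 (fun i k => v i (k + j)%N).
      by apply: fps2_recYn => -[|i] k lt_k //=; apply: (hj.1 k).
    have := ph'; rewrite eh rmorphD rmorphM /= x0 mul0r add0r.
    rewrite ev rmorphM rmorphXn.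
    case/fps1_mulf_eq0 => [/fps1_expf_eq0 //|] /=.
    move/(congr1 (fun u : fps1 K => u 0%N)); rewrite arc_coef0 /= add0n => /eqP.
    by have /negPf := hj.2; rewrite /= => ->.
  by have [_] := w1; rewrite (arc_trivial _ x0 y0) /= mulr0 eqxx.
have [e xe] := ordn_ex (introN eqP x0).
have ap g k : ordn (phi g) k -> (k < n.+2)%N ->
    exists g', ordn (phi (beta g')) (e * n.+2 + k).
  move=> gk lt_k; have [g' [rho [eg hrho]]] := blowup_approx phi bX bY n.+2 g.
  exists g'; rewrite eg; apply: ordnM; first exact: ordnX.
  by apply: ordn_congr => //; apply: ordge_le hrho.
have [g1' w1'] := ap _ _ w1 (ltnSn _).
have [g2' w2'] := ap _ _ w2 (ltnW (ltnSn _)).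
exists (phi \o beta).
  by rewrite /= bh rmorphM /= ph' mulr0.
by exists g1', g2', (e * n.+2 + n)%N; rewrite -addnS.
Qed.

Lemma has_arc_swap h : has_arc (swap2 h) -> has_arc h.
Proof.
have swapK g : swap2 (swap2 g) = g by apply: fps2P.
case=> phi e0 [g1 [g2 [n [w1 w2]]]]; exists (phi \o swap2 (K:=K)) => //.
by exists (swap2 g1), (swap2 g2), n; rewrite /= !swapK.
Qed.

(** If the multiplicity never drops, the arc is (t, C 0) with
C n = c_n t + c_(n+1) t^2 + ...: after n blowing-ups, h_0 restricted to it is
t^(m n) times the restriction of h_n to (t, C n), so it is 0. *)
Lemma has_arc_blowups m (h : nat -> fps2 K) (c : nat -> K) : (0 < m)%N ->
  (forall n, blowup m (c n) (h n) (h n.+1)) -> has_arc (h 0%N).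
Proof.
move=> m0 bl.
pose C n : fps1 K := FPS1 (fun i => if i is i'.+1 then c (n + i')%N else 0).
have CE n : C n = T * (C n.+1 + (c n)%:A).
  apply: fps1P => i; rewrite coefTM; case: i => // i.
  rewrite coef1D /=; case: i => [|i]; first by rewrite addn0 mulr1 add0r.
  by rewrite mulr0 addr0 addnS.
have ex n := cid (@arc_of_ex (C n) erefl).
pose phi n := projT1 (ex n).
have phiX n : phi n X = T by case: (projT2 (ex n)).
have phiY n : phi n Y = C n by case: (projT2 (ex n)).
have phiE n : phi n (h n) = T ^+ m * phi n.+1 (h n.+1).
  have [beta [bX bY bh]] := bl n.
  have -> : phi n (h n) = (phi n.+1 \o beta) (h n).
    apply: arc_ext; rewrite /= ?bX ?bY ?rmorphM ?phiX //.
    by rewrite rmorphD /= rmorph_alg !phiX !phiY -CE.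
  by rewrite /= bh rmorphM rmorphXn /= phiX.
exists (phi 0%N).
  apply: ordge_all => n; suff : forall k, ordge n (phi k (h k)) by [].
  elim: n => [//|n IH] k; rewrite phiE.
  apply: ordge_le (ordgeM (ordnTX K m).1 (IH _)).
  by rewrite -add1n leq_add2r.
exists X, 1, 0%N; rewrite phiX rmorph1.
by split; split=> //=; [case | rewrite oner_neq0 | rewrite oner_neq0].
Qed.

End Arcs.

Section ArcExistence.
Variable K : closedFieldType.
Implicit Types h : fps2 K.

(** Existence of a parametrization, by induction on the multiplicity m.  A
counterexample of multiplicity m only admits strict transforms of the same
multiplicity, and [has_arc_blowups] applies to an infinite sequence of them. *)
Lemma has_arc_ex h m : has_order h m -> (0 < m)%N -> has_arc h.
Proof.
elim/ltn_ind: m h => m IH h0 hm0 m0; apply: contrapT => nh0.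
(* The leading form has a root of finite slope as soon as it involves y.  After
one blowing-up it contains y^m, so that no further exchange of the variables
is needed. *)
pose S h := [/\ has_order h m, h 0%N m != 0 & ~ has_arc h].
have step1 h : has_order h m -> ~ has_arc h ->
    size (\poly_(k < m.+1) h (m - k)%N k) != 1%N ->
    exists c h', blowup m c h h' /\ S h'.
  move=> hm nh /closed_rootP[c pc].
  have [h' [j [bl /andP[j0 le_jm] hj]]] := blowup_ex hm pc.
  have nh' : ~ has_arc h' by move=> /(has_arc_blowup j0 hj bl).
  have hj0 : h' 0%N j != 0 := hj.2.
  have [k hk] : exists k, has_order h' k.
    by apply: has_order_ex => h'0; rewrite h'0 eqxx in hj0.
  have le_kj : (k <= j)%N.
    by rewrite leqNgt; apply: contraNN hj0 => lt_jk; rewrite hk.1.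
  have k0 : (0 < k)%N.
    rewrite lt0n; apply/eqP => k0; rewrite k0 in hk.
    case: hk => _ [i1 [j1 [e /eqP]]]; apply.
    have [-> ->] : i1 = 0%N /\ j1 = 0%N by lia.
    exact: (hj.1 0%N).
  have ekm : k = m.
    apply/eqP; rewrite eqn_leq (leq_trans le_kj) //= leqNgt.
    apply/negP => lt_km.
    exact: nh' (IH _ lt_km _ hk k0).
  exists c, h'; split=> //; split=> //; first by rewrite -ekm.
  by have -> : m = j by lia.
have stepS h : S h -> exists c h', blowup m c h h' /\ S h'.
  move=> [hm hY nh]; apply: step1 => //; apply/eqP => sz.
  have := leq_sizeP _ 1%N (eq_leq sz) m m0.
  by rewrite coef_poly ltnSn subnn; apply/eqP.
have [h1 Sh1] : exists h1, S h1.
  have [sz|/negPn/eqP sz] :=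
    boolP (size (\poly_(k < m.+1) h0 (m - k)%N k) != 1%N).
    by have [c [h' [_]]] := step1 _ hm0 nh0 sz; exists h'.
  exists (swap2 h0); split.
  - case: hm0 => lo [i [j [e hij]]]; split; last by exists j, i; rewrite addnC.
    by move=> i' j'; rewrite addnC; apply: lo.
  - have [_ [i [j [e hij]]]] := hm0; rewrite /=.
    have : (\poly_(k < m.+1) h0 (m - k)%N k)`_j != 0.
      by rewrite coef_poly -e ltnS leq_addl addnK.
    case: j e hij => [|j] e hij _; first by rewrite -e addn0.
    have := leq_sizeP _ 1%N (eq_leq sz) j.+1 isT.
    rewrite coef_poly -e ltnS leq_addl addnK => z.
    by rewrite z eqxx in hij.
  - by move/has_arc_swap.
pose next (s : {h | S h}) : {h | S h} :=
  let: exist h Sh := s in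
  let: exist _ e := cid (stepS h Sh) in
  let: exist h' p := cid e in exist _ h' p.2.
have nextP s : exists c, blowup m c (sval s) (sval (next s)).
  case: s => h Sh /=; case: (cid (stepS h Sh)) => c e; case: (cid e) => h' p /=.
  by exists c; case: p.
pose s n := iter n next (exist _ h1 Sh1).
pose c n := projT1 (cid (nextP (s n))).
have [_ _] := Sh1; apply.
apply: (@has_arc_blowups _ m (fun n => sval (s n)) c m0).
by move=> n; apply: (projT2 (cid (nextP (s n)))).
Qed.

End ArcExistence.

(** * The kernel of an arc *)

Section Kernel.
Variable K : fieldType.
Implicit Types (f g h : fps2 K) (phi : {lrmorphism fps2 K -> fps1 K}).

Local Notation X := (fpsX K).
Local Notation Y := (fpsY K).
Local Notation T := (fpsT K).

Lemma primitive_arc_neq0 phi : primitive_arc phi -> phi X <> 0 \/ phi Y <> 0.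
Proof.
case=> g1 [g2 [n [w1 _]]]; apply: contrapT.
move=> /not_orP[/contrapT x0 /contrapT y0].
by have [_] := w1; rewrite (arc_trivial _ x0 y0) /= mulr0 eqxx.
Qed.

(** When phi X <> 0, let H in the kernel have the least order N of H(0,y).  The
remainder of a division by H lies in the kernel; divided by the largest power
of x, which phi does not kill, it would have smaller order in y. *)
Lemma arc_kernel_principal phi : phi X <> 0 \/ phi Y <> 0 ->
  (exists2 g, g <> 0 & phi g = 0) ->
  exists2 H, phi H = 0 & forall f, phi f = 0 -> divides H f.
Proof.
move=> nt [g0 g0n g0k].
have [x0|/eqP x0] := eqVneq (phi X) 0.
  have y0 : phi Y <> 0 by case: nt.
  exists X => // f fk.
  pose v := FPS2 (fun i k => if i is 0%N then f 0%N k else 0) : fps2 K.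
  have ef : f = X * FPS2 (fun i k => f i.+1 k) + v.
    by apply: fps2P => -[|i] k; rewrite coef2D coef2XM ?add0r ?addr0.
  have vk : phi v = 0.
    by have := fk; rewrite {1}ef rmorphD rmorphM /= x0 mul0r add0r.
  suff v0 : v = 0 by rewrite ef v0 addr0 mulrC; eexists.
  apply: contrapT => /has_order_ex[j [lo [i [k [eik vik]]]]].
  have i0 : i = 0%N by case: (i) vik => // ?; rewrite eqxx.
  have ek : k = j by rewrite -eik i0.
  have ev : v = Y ^+ j * FPS2 (fun i k => v i (k + j)%N).
    by apply: fps2_recYn => -[|i'] k' lt_k //; apply: lo.
  move: vk; rewrite ev rmorphM rmorphXn.
  case/fps1_mulf_eq0 => [/fps1_expf_eq0 //|] /=.
  move/(congr1 (fun u : fps1 K => u 0%N)); rewrite arc_coef0 /= add0n => /eqP.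
  by move: vik; rewrite i0 ek /= => /negPf ->.
(* The kernel is prime, so powers of x can be removed from its elements. *)
have strip r : r <> 0 -> phi r = 0 ->
    exists i r', [/\ phi r' = 0, (exists j, r' 0%N j != 0) &
      forall i' j, r' i' j = r (i' + i)%N j].
  move=> rn rk.
  have ex : exists i, `[< exists j, r i j != 0 >].
    apply: contrapT => h; apply: rn; apply: fps2P => i j; apply/eqP.
    apply: contrapT => /negP hij; apply: h; exists i.
    by apply/asboolP; exists j.
  case: (ex_minnP ex) => i /asboolP ri min_i.
  exists i, (FPS2 (fun i' j => r (i' + i)%N j)); split=> //.
  have er : r = X ^+ i * FPS2 (fun i' j => r (i' + i)%N j).
    apply: fps2_recXn => i' j lt_i.
    apply/eqP; apply: contrapT => /negP hij.
    suff : (i <= i')%N by rewrite leqNgt lt_i.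
    by apply: min_i; apply/asboolP; exists j.
  move: rk; rewrite {1}er rmorphM rmorphXn.
  by case/fps1_mulf_eq0 => // /fps1_expf_eq0.
have ex : exists N, `[< exists2 H, phi H = 0 & H 0%N N != 0 >].
  have [i [r' [rk [j rj] _]]] := strip _ g0n g0k.
  by exists j; apply/asboolP; exists r'.
case: (ex_minnP ex) => N /asboolP[H Hk HN] min_N.
have low f j : phi f = 0 -> (j < N)%N -> f 0%N j = 0.
  move=> fk lt_j; apply/eqP; apply: contrapT => /negP fj.
  suff : (N <= j)%N by rewrite leqNgt lt_j.
  by apply: min_N; apply/asboolP; exists f.
exists H => // f fk.
have [q [r [ef hr]]] := weierstrass_division (fun j => @low H j Hk) HN f.
suff r0 : r = 0 by exists q; rewrite ef r0 addr0.
have rk : phi r = 0.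
  by have := fk; rewrite ef rmorphD rmorphM /= Hk mulr0 add0r.
apply: contrapT => rn; have [i [r' [rk' [j /eqP rj] er']]] := strip _ rn rk.
apply: rj; have [lt_j|le_j] := ltnP j N; first exact: low.
by rewrite er' hr.
Qed.

Lemma arc_kernel phi h f : irreducible h -> phi h = 0 -> primitive_arc phi ->
  phi f = 0 -> divides h f.
Proof.
case=> /eqP hn hnu hirr hk /primitive_arc_neq0 nt fk.
have [|H Hk Hdiv] := arc_kernel_principal nt; first by exists h.
have [q eq] := Hdiv _ hk; have [q' eq'] := Hdiv _ fk.
case: (hirr _ _ eq) => [qu|].
  by exists (q' * q^-1); rewrite eq' eq mulrA divrK.
by rewrite fps2_unitE -(arc_coef0 phi) Hk eqxx.
Qed.

End Kernel.

(** * Integrality of K[[t]] over the image of an arc *)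

Section Integrality.
Variable K : fieldType.
Implicit Types (f g h : fps2 K) (b u : fps1 K).
Variable phi : {lrmorphism fps2 K -> fps1 K}.

Local Notation X := (fpsX K).
Local Notation Y := (fpsY K).
Local Notation T := (fpsT K).

Lemma ordn_divides b u n : ordn b n -> ordge n u -> exists v, u = v * b.
Proof.
have recn a k : ordge k a -> a = T ^+ k * FPS1 (fun i => a (i + k)%N).
  elim: k a => [|k IH] a ha.
    by rewrite expr0 mul1r; apply: fps1P => i /=; rewrite addn0.
  rewrite {1}[a]fps1_recl ha // scale0r add0r.
  rewrite [FPS1 _ in LHS]IH => [|i lt_i]; last exact: ha.
  by rewrite mulrA -exprS; congr (_ * _); apply: fps1P => i /=; rewrite addnS.
move=> [hb bn] hu; rewrite [b](recn _ n) // [u](recn _ n) //.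
have [//|w hw] := @fps1_unit0 _ (FPS1 (fun i => b (i + n)%N)).
exists (FPS1 (fun i => u (i + n)%N) * w).
by rewrite mulrCA -mulrA [w * _]mulrC hw mulr1.
Qed.

Lemma fps1_take n b : exists u,
  b = \sum_(i < n) (b i)%:A * T ^+ i + T ^+ n * u.
Proof.
suff h : ordge n (b - \sum_(i < n) (b i)%:A * T ^+ i).
  have [u eu] := ordn_divides (ordnTX K n) h.
  by exists u; rewrite mulrC -eu addrC subrK.
have TX k i : (T ^+ k) i = (i == k)%:R :> K.
  elim: k i => [|k IH] i; first by rewrite expr0.
  by rewrite exprS coefTM; case: i => [|i]; rewrite ?IH.
move=> i lt_i; rewrite coef1D.
have -> : (- \sum_(i < n) (b i)%:A * T ^+ i) i =
    - (\sum_(k < n) b k * (i == k)%:R).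
  transitivity (- ((\sum_(i < n) (b i)%:A * T ^+ i) i)); first by [].
  congr (- _); elim/big_rec2: _ => // k x y _ <-.
  by rewrite mulr_algl coef1D -TX.
rewrite (bigD1 (Ordinal lt_i)) //= eqxx mulr1 big1 ?addr0 ?subrr // => k.
by move=> /negPf; rewrite -val_eqE /= eq_sym => ->; rewrite mulr0.
Qed.

(** With e = ord (phi z), every b is sum_(i < e) b_i t^i + phi z * b', and
iterating on b' collects the coefficients of each t^i into a series in z. *)
Lemma arc_span z e (ser : (nat -> K) -> fps2 K) :
  (forall a, ser a = (a 0%N)%:A + z * ser (fun n => a n.+1)) ->
  ordn (phi z) e -> (0 < e)%N ->
  forall b, exists a : 'I_e -> fps2 K, b = \sum_(i < e) phi (a i) * T ^+ i.
Proof.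
move=> serE ze e0 b.
have stepE (c : fps1 K) :
    exists c', c = \sum_(i < e) (c i)%:A * T ^+ i + phi z * c'.
  have [u eu] := fps1_take e c.
  have [w ew] := ordn_divides ze (ordnTX K e).1.
  by exists (w * u); rewrite {1}eu ew mulrAC mulrC mulrA.
pose next (c : fps1 K) := projT1 (cid (stepE c)).
have nextE (c : fps1 K) : c = \sum_(i < e) (c i)%:A * T ^+ i + phi z * next c.
  by rewrite /next; case: (cid _).
pose s (c : fps1 K) n := iter n next c.
pose a (c : fps1 K) (i : 'I_e) := ser (fun n => s c n i).
pose err (c : fps1 K) := c - \sum_(i < e) phi (a c i) * T ^+ i.
have errE c : err c = phi z * err (next c).
  rewrite /err {1}[c]nextE mulrBr mulr_sumr.
  have -> : \sum_(i < e) phi (a c i) * T ^+ i =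
    \sum_(i < e) (c i)%:A * T ^+ i +
    \sum_(i < e) phi z * (phi (a (next c) i) * T ^+ i).
    rewrite -big_split; apply: eq_bigr => i _ /=.
    rewrite /a serE rmorphD rmorphM /= rmorph_alg mulrDl -mulrA.
    congr (_ + _ * (phi _ * _)).
    by congr ser; apply/funext => n; rewrite /s -iterSr.
  by rewrite opprD addrACA subrr add0r.
exists (a b); apply/eqP; rewrite -subr_eq0; apply/eqP; rewrite -/(err b).
apply: ordge_all => n; elim: n (b) => [//|n IH] c; rewrite errE.
by apply: ordge_le (ordgeM ze.1 (IH _)); rewrite -add1n leq_add2r.
Qed.

Lemma arc_span_ex : phi X <> 0 \/ phi Y <> 0 -> exists2 e, (0 < e)%N &
  forall b, exists a : 'I_e -> fps2 K, b = \sum_(i < e) phi (a i) * T ^+ i.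
Proof.
case=> /eqP /ordn_ex[e ze]; exists e.
- exact: ordge_ordn (arcX_ordge phi) ze.
- pose ser (a : nat -> K) := FPS2 (fun i j => if j == 0%N then a i else 0).
  apply: (arc_span (ser := ser) _ ze).
    move=> a; apply: fps2P => i j; rewrite coef2D coef2XM coef2Z coef21 /=.
    by case: i j => [|i] [|j]; rewrite ?mulr1 ?mulr0 ?add0r ?addr0.
  exact: ordge_ordn (arcX_ordge phi) ze.
- exact: ordge_ordn (arcY_ordge phi) ze.
- pose ser (a : nat -> K) := FPS2 (fun i j => if i == 0%N then a j else 0).
  apply: (arc_span (ser := ser) _ ze).
    move=> a; apply: fps2P => i j; rewrite coef2D coef2YM coef2Z coef21 /=.
    by case: i j => [|i] [|j]; rewrite ?mulr1 ?mulr0 ?add0r ?addr0.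
  exact: ordge_ordn (arcY_ordge phi) ze.
Qed.

(** The determinant trick: multiplication by u acts on the generators t^i of
K[[t]] by a matrix with entries in the image, whose characteristic polynomial
kills u. *)
Lemma arc_integral u : phi X <> 0 \/ phi Y <> 0 -> exists n (c : nat -> fps2 K),
  u ^+ n = \sum_(i < n) phi (c i) * u ^+ i.
Proof.
move=> /arc_span_ex[e e0 span].
have ex (i : 'I_e) := cid (span (u * T ^+ i)).
pose M := \matrix_(i < e, j < e) projT1 (ex i) j.
pose A := map_mx phi M.
pose v : 'cV[fps1 K]_e := \col_j T ^+ j.
have Av : A *m v = u *: v.
  apply/matrixP => i j; rewrite !mxE (projT2 (ex i)).
  by apply: eq_bigr => k _; rewrite !mxE.
have det0 : \det (u%:M - A) = 0.
  have : \adj (u%:M - A) *m ((u%:M - A) *m v) = 0.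
    by rewrite mulmxBl Av mul_scalar_mx subrr mulmx0.
  rewrite mulmxA mul_adj_mx mul_scalar_mx => /matrixP /(_ (Ordinal e0) ord0).
  by rewrite !mxE expr0 mulr1.
pose p := char_poly M.
have pu : (map_poly phi p).[u] = 0.
  rewrite -det0 /p map_char_poly /char_poly -horner_evalE -det_map_mx.
  congr (\det _); apply/matrixP => i j; rewrite !mxE /horner_eval.
  by rewrite /= /horner_eval hornerD hornerN hornerC hornerMn hornerX.
have sp : size p = e.+1 by rewrite size_char_poly.
have le_p : (size (map_poly phi p) <= e.+1)%N by rewrite -sp size_poly.
exists e, (fun i => - p`_i); apply/eqP; rewrite -subr_eq0; apply/eqP.
rewrite -[RHS]pu (horner_coef_wide _ le_p) big_ord_recr /= coef_map.
have /monicP := char_poly_monic M; rewrite /lead_coef -/p sp /= => ->.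
rewrite rmorph1 mul1r addrC; congr (_ + _); rewrite -sumrN.
by apply: eq_bigr => i _; rewrite coef_map rmorphN mulNr opprK.
Qed.

End Integrality.

(** * Ideals of finite codimension *)

Section Ideals.
Variable K : fieldType.
Implicit Types (f g h : fps2 K) (J W : fps2 K -> Prop).

Local Notation X := (fpsX K).
Local Notation Y := (fpsY K).

Definition ideal J : Prop :=
  [/\ J 0, forall u v, J u -> J v -> J (u + v) & forall r u, J u -> J (r * u)].

Lemma ideal_subspace J : ideal J -> subspace J.
Proof.
case=> J0 JD JM; split=> // a u v Ju Jv; apply: JD => //.
by rewrite -mulr_algl; apply: JM.
Qed.

Lemma idealB J u v : ideal J -> J u -> J v -> J (u - v).
Proof.
by case=> _ JD JM Ju Jv; apply: JD => //; rewrite -mulN1r; apply: JM.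
Qed.

Lemma ideal2_ideal f g : ideal (ideal2 f g).
Proof.
split.
- by exists 0, 0; rewrite !mul0r addr0.
- by move=> _ _ [a [b ->]] [a' [b' ->]]; exists (a + a'), (b + b'); ring.
- by move=> r _ [a [b ->]]; exists (r * a), (r * b); ring.
Qed.

Lemma ideal2_subspace f g : subspace (ideal2 f g).
Proof. exact/ideal_subspace/ideal2_ideal. Qed.

Lemma ideal2C f g r : ideal2 f g r <-> ideal2 g f r.
Proof. by split=> -[a [b ->]]; exists b, a; rewrite addrC. Qed.

Lemma ideal2_proper f g : f 0%N 0%N = 0 -> g 0%N 0%N = 0 -> ~ ideal2 f g 1.
Proof.
move=> f0 g0 [a [b /(congr1 (fun u : fps2 K => u 0%N 0%N))]].
rewrite coef21 coef2D !coef2M !big_ord1 !subn0 f0 g0 !mulr0 addr0 => /eqP.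
by rewrite oner_eq0.
Qed.

Lemma i0C f g : i0 f g = i0 g f.
Proof.
rewrite /i0; congr quotient_dim; apply/funext => r; apply/propext.
exact: ideal2C.
Qed.

Definition mulf z : fps2 K -> fps2 K := fun u => z * u.

Lemma mulf_is_zmod_morphism z : zmod_morphism (mulf z).
Proof. by move=> u v; rewrite /mulf mulrBr. Qed.

Lemma mulf_is_scalable z : scalable (mulf z).
Proof. by move=> c u; rewrite /mulf scalerAr. Qed.

HB.instance Definition _ z := GRing.isZmodMorphism.Build _ _ (mulf z)
  (mulf_is_zmod_morphism z).
HB.instance Definition _ z := GRing.isScalable.Build _ _ _ _ (mulf z)
  (mulf_is_scalable z).

Lemma codim_mul z J W W' n m :
  ideal J -> ideal W -> ideal W' ->
  (forall u, W (z * u) <-> J u) ->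
  (forall v, W' v <-> exists u, W (v - z * u)) ->
  codim J n -> codim W' m -> codim W (n + m).
Proof.
move=> /ideal_subspace sJ /ideal_subspace sW /ideal_subspace sW' JP W'P.
exact: (codimD (g := mulf z)) sJ sW sW' JP W'P.
Qed.

Definition colon J z : fps2 K -> Prop := fun u => J (z * u).

(** The ideal J + zR. *)
Definition adjoin J z : fps2 K -> Prop := fun v => exists u, J (v - z * u).

Lemma colon_ideal J z : ideal J -> ideal (colon J z).
Proof.
case=> J0 JD JM; split; first by rewrite /colon mulr0.
  by move=> u v Ju Jv; rewrite /colon mulrDr; apply: JD.
by move=> r u Ju; rewrite /colon mulrCA; apply: JM.
Qed.

Lemma adjoin_ideal J z : ideal J -> ideal (adjoin J z).
Proof.
case=> J0 JD JM; split; first by exists 0; rewrite mulr0 subr0.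
  move=> u v [c Jc] [d Jd]; exists (c + d).
  by rewrite mulrDr opprD addrACA; apply: JD.
by move=> r u [c Jc]; exists (r * c); rewrite mulrCA -mulrBr; apply: JM.
Qed.

Lemma adjoin_sub J z v : J v -> adjoin J z v.
Proof. by exists 0; rewrite mulr0 subr0. Qed.

Lemma adjoin_mem J z : ideal J -> adjoin J z z.
Proof. by case=> J0 _ _; exists 1; rewrite mulr1 subrr. Qed.

(** Exactness of 0 -> R/(J : z) -> R/J -> R/(J + zR) -> 0. *)
Lemma codim_colon_adjoin z J : ideal J ->
  (exists n, codim (colon J z) n) -> (exists m, codim (adjoin J z) m) ->
  exists k, codim J k.
Proof.
move=> iJ [n hn] [m hm]; exists (n + m)%N.
have [iC iA] := (colon_ideal z iJ, adjoin_ideal z iJ).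
by apply: (codim_mul (z := z) iC iJ iA _ _ hn hm); move=> ?; split.
Qed.

Lemma codim_maximal J : ideal J -> J X -> J Y -> ~ J 1 -> codim J 1.
Proof.
move=> iJ JX JY nJ1; have [J0 JD JM] := iJ.
exists (fun=> 1) => f.
have fJ : J (f - (f 0%N 0%N)%:A).
  rewrite {1}[f]fps2_recl; set u := FPS2 _; set v := FPS2 _.
  have -> : (f 0%N 0%N)%:A + X * u + Y * v - (f 0%N 0%N)%:A = u * X + v * Y.
    by set c := _%:A; ring.
  by apply: JD; apply: JM.
exists (const_mx (f 0%N 0%N)); split; first by rewrite big_ord1 mxE.
move=> c; rewrite big_ord1 => cJ; apply/rowP => i; rewrite !ord1 mxE.
apply/eqP; rewrite -subr_eq0; apply: contrapT => /negP d0; apply: nJ1.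
have := idealB iJ cJ fJ; rewrite opprB addrC subrKA -scalerBl -mulr_algl mulr1.
move=> /(JM ((f 0%N 0%N - c ord0 ord0)^-1)%:A).
by rewrite mulr_algl scalerA mulVf // scale1r.
Qed.

Lemma codim_ideal J a b : ideal J -> J (X ^+ a) -> J (Y ^+ b) ->
  exists n, codim J n.
Proof.
have full J' : ideal J' -> J' 1 -> exists n, codim J' n.
  case=> _ _ JM J1; exists 0%N; apply: codimT => v.
  by rewrite -[v]mulr1; apply: JM.
elim: a J => [|a IHa] J iJ Ja Jb; first exact: full.
apply: (codim_colon_adjoin (z := X) iJ).
  apply: IHa; [exact: colon_ideal | by rewrite /colon -exprS |].
  by have [_ _ JM] := iJ; apply: JM.
have {IHa Ja} := adjoin_mem X iJ; have := adjoin_sub X Jb.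
move: {J iJ Jb} (adjoin J X) (adjoin_ideal X iJ) => J iJ Jb JX.
elim: b J iJ Jb JX => [|b IHb] J iJ Jb JX; first exact: full.
have [J0 _ JM] := iJ.
apply: (codim_colon_adjoin (z := Y) iJ).
  apply: IHb; [exact: colon_ideal | by rewrite /colon -exprS | exact: JM].
have iJY := adjoin_ideal Y iJ.
have [J1|nJ1] := pselect (adjoin J Y 1); first exact: full.
exists 1%N; apply: codim_maximal => //; first exact: adjoin_sub.
exact: adjoin_mem.
Qed.

End Ideals.

(** * Intersection numbers are proportional to orders along an arc *)

Section ArcValuation.
Variables (K : fieldType) (h : fps2 K) (phi : {lrmorphism fps2 K -> fps1 K}).
Hypotheses (h_irr : irreducible h) (phih : phi h = 0)
  (phi_prim : primitive_arc phi).
Implicit Types (f g z : fps2 K) (J : fps2 K -> Prop).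

Local Notation X := (fpsX K).
Local Notation Y := (fpsY K).

Lemma arc_kernelP f : phi f = 0 <-> divides h f.
Proof.
split; first exact: (arc_kernel h_irr).
by case=> c ->; rewrite rmorphM /= phih mulr0.
Qed.

Let integral u := @arc_integral K phi u (primitive_arc_neq0 phi_prim).

(** Some power zn of z has phi zn = u * phi g; multiplying an integral equation
of u by a power of g puts a power of zn into (g, h). *)
Lemma arc_power_in_ideal J g z : ideal J -> J h -> J g -> phi g <> 0 ->
  z 0%N 0%N = 0 -> exists M, J (z ^+ M).
Proof.
move=> iJ Jh Jg /eqP/ordn_ex[n gn] z0; have [J0 JD JM] := iJ.
have kerJ f : phi f = 0 -> J f by move/arc_kernelP => [c ->]; apply: JM.
have [pz|/eqP/eqP/ordn_ex[e ze]] := eqVneq (phi z) 0.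
  by exists 1%N; apply: kerJ.
have e0 : (0 < e)%N.
  by apply: (@ordge_ordn _ _ _ 1 _ ze) => -[|] //; rewrite arc_coef0.
have [u eu] : exists u, phi (z ^+ n) = u * phi g.
  apply: (ordn_divides gn); rewrite rmorphXn; apply: ordge_le (ordnX n ze).1.
  by rewrite leq_pmull.
have [k [c ek]] := integral u.
exists (n * k)%N; rewrite exprM; move: (z ^+ n) eu => zn eu.
case: k => [|k] in ek *.
  have : phi 1 = 0 by rewrite rmorph1 -(expr0 u) ek big_ord0.
  by move/kerJ; rewrite expr0.
pose r := \sum_(i < k.+1) c i * zn ^+ i * g ^+ (k - i).
have er : phi (zn ^+ k.+1 - g * r) = 0.
  rewrite rmorphB rmorphM rmorphXn /= eu exprMn ek mulr_suml /r rmorph_sum.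
  rewrite mulr_sumr; apply/eqP; rewrite subr_eq0; apply/eqP.
  apply: eq_bigr => -[i /= le_i] _; rewrite !rmorphM !rmorphXn /= eu exprMn.
  have -> : phi g ^+ k.+1 = phi g * phi g ^+ i * phi g ^+ (k - i).
    by rewrite -exprS -exprD addSn subnKC.
  ring.
rewrite -[_ ^+ _](subrK (g * r)).
by apply: JD; [apply: kerJ | rewrite mulrC; apply: JM].
Qed.

Lemma codim_arc_ideal J g : ideal J -> J h -> J g -> phi g <> 0 ->
  exists n, codim J n.
Proof.
move=> iJ Jh Jg g0.
have [a Ja] := arc_power_in_ideal iJ Jh Jg g0 (erefl : X 0%N 0%N = 0).
have [b Jb] := arc_power_in_ideal iJ Jh Jg g0 (erefl : Y 0%N 0%N = 0).
exact: codim_ideal iJ Ja Jb.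
Qed.

Lemma codim_ideal2 g : phi g <> 0 -> exists n, codim (ideal2 g h) n.
Proof.
apply: codim_arc_ideal; first exact: ideal2_ideal.
  by exists 0, 1; rewrite mul0r add0r mul1r.
by exists 1, 0; rewrite mul0r addr0 mul1r.
Qed.

Lemma codim_ideal2M g1 g2 n1 n2 : phi g1 <> 0 ->
  codim (ideal2 g1 h) n1 -> codim (ideal2 g2 h) n2 ->
  codim (ideal2 (g1 * g2) h) (n1 + n2).
Proof.
move=> g10 c1 c2; rewrite addnC.
apply: (@codim_mul _ g1 _ _ _ _ _ _ _ _ _ _ c2 c1); try exact: ideal2_ideal.
- move=> u; split=> [[a [b e]]|[a [b ->]]]; last first.
    by exists a, (g1 * b); ring.
  have : phi (g1 * (u - a * g2)) = 0.
    rewrite (_ : g1 * (u - a * g2) = b * h) ?rmorphM /= ?phih ?mulr0 //.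
    by rewrite mulrBr e; ring.
  rewrite rmorphM => /fps1_mulf_eq0[//|/arc_kernelP[c ec]].
  by exists a, c; rewrite -ec addrC subrK.
- move=> v; split=> [[a [b ->]]|[u [a [b e]]]].
    by exists a, 0, b; ring.
  by exists (a * g2 + u), b; rewrite -[v](subrK (g1 * u)) e; ring.
Qed.

(** The elements that stay in the image of phi under all powers of u form an
ideal J stable under u, nonzero modulo h because u is integral.  Comparing
codim (g J + (h)) = codim (g, h) + codim J for g1 and g2 gives the claim. *)
Lemma codim_ideal2_homo g1 g2 n1 n2 u : phi g1 <> 0 -> phi g2 <> 0 ->
  phi g1 = u * phi g2 ->
  codim (ideal2 g1 h) n1 -> codim (ideal2 g2 h) n2 -> (n2 <= n1)%N.
Proof.
move=> g10 g20 eu c1 c2.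
pose J a := forall i, exists r, phi a * u ^+ i = phi r.
have iJ : ideal J.
  split; first by move=> i; exists 0; rewrite !rmorph0 mul0r.
    move=> a b Ja Jb i; have [[r er] [s es]] := (Ja i, Jb i).
    by exists (r + s); rewrite !rmorphD mulrDl er es.
  move=> a b Jb i; have [r er] := Jb i.
  by exists (a * r); rewrite !rmorphM -mulrA er.
have Jh : J h by move=> i; exists 0; rewrite phih rmorph0 mul0r.
have [k [c ek]] := integral u.
(* Multiplying by phi g2 ^ k clears the powers of u below k, and the integral
equation reduces the others to these. *)
have Jg : J (g2 ^+ k).
  elim/ltn_ind => i IH; have [lt_i|le_i] := ltnP i k.
    exists (g1 ^+ i * g2 ^+ (k - i)); rewrite rmorphM !rmorphXn /= eu exprMn.
    by rewrite -[in LHS](subnKC (ltnW lt_i)) exprD; ring.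
  have ex (j : 'I_k) := cid (IH (i - k + j)%N (ltac:(have := ltn_ord j; lia))).
  exists (\sum_(j < k) c j * sval (ex j)).
  rewrite -[in u ^+ i](subnK le_i) exprD ek rmorph_sum !mulr_sumr.
  apply: eq_bigr => j _; rewrite rmorphM /= -(svalP (ex j)) exprD; ring.
have gk0 : phi (g2 ^+ k) <> 0.
  by rewrite rmorphXn => /fps1_expf_eq0.
have [d cJ] := codim_arc_ideal iJ Jh Jg gk0.
pose W g v := exists2 a, J a & divides h (v - g * a).
have iW g : ideal (W g).
  split; first by exists 0; [case: iJ | exists 0; rewrite mulr0 subr0 mul0r].
    move=> a b [a' Ja [p ep]] [b' Jb [q eq]]; exists (a' + b').
      by case: iJ => _ JD _; apply: JD.
    by exists (p + q); rewrite mulrDr opprD addrACA ep eq mulrDl.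
  move=> r a [a' Ja [p ep]]; exists (r * a'); first by case: iJ => _ _; apply.
  by exists (r * p); rewrite mulrCA -mulrBr ep mulrA.
have cW g n : phi g <> 0 -> codim (ideal2 g h) n -> codim (W g) (d + n).
  move=> g0 cg.
  apply: (@codim_mul _ g _ _ _ _ _ iJ (iW g) (ideal2_ideal g h) _ _ cJ cg).
    move=> v; split=> [[a Ja [p ep]]|Jv]; last first.
      by exists v => //; exists 0; rewrite subrr mul0r.
    have : phi (g * (v - a)) = 0.
      by rewrite mulrBr ep rmorphM /= phih mulr0.
    rewrite rmorphM => /fps1_mulf_eq0[//|va].
    move=> i; have [r er] := Ja i; exists r; rewrite -er; congr (_ * _).
    by apply/eqP; rewrite -subr_eq0 -rmorphB va.
  move=> v; split=> [[a [b ->]]|[a [a' Ja [p ep]]]].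
    exists a, 0; first by case: iJ.
    by exists b; ring.
  by exists (a + a'), p; rewrite -ep; ring.
have := le_codim (ideal_subspace (iW g2)) _ (cW _ _ g10 c1) (cW _ _ g20 c2).
rewrite leq_add2l; apply => v [a Ja [p ep]].
have [r er] := Ja 1%N; rewrite expr1 in er.
exists r.
  move=> i; have [s es] := Ja i.+1; exists s; rewrite -es -er exprS; ring.
have /arc_kernelP[q eq] : phi (g1 * a - g2 * r) = 0.
  by rewrite rmorphB !rmorphM /= -er eu; ring.
exists (p + q); rewrite mulrDl -ep -eq; ring.
Qed.

(** For ord (phi g) = n, the elements g1^n and g * g2^n have the same order,
hence the same codimension: n * n1 = codim (g, h) + n * n2. *)
Theorem codim_ordn : exists kappa,
  forall g n, ordn (phi g) n -> codim (ideal2 g h) (kappa * n).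
Proof.
have [g1 [g2 [m [w1 w2]]]] := phi_prim.
have nz g n : ordn (phi g) n -> phi g <> 0 by move/ordn_neq0/eqP.
have [n1 c1] := codim_ideal2 (nz _ _ w1).
have [n2 c2] := codim_ideal2 (nz _ _ w2).
have cX g n c k : ordn (phi g) n -> codim (ideal2 g h) c ->
    codim (ideal2 (g ^+ k) h) (k * c).
  move=> gn gc; elim: k => [|k IH]; last first.
    by rewrite exprS mulSn; apply: codim_ideal2M => //; apply: nz gn.
  apply: codimT => v; exists v, 0; ring.
have le g g' n n' c c' : ordn (phi g) n -> ordn (phi g') n' -> (n' <= n)%N ->
    codim (ideal2 g h) c -> codim (ideal2 g' h) c' -> (c' <= c)%N.
  move=> gn gn' le_n; have [u eu] := ordn_divides gn' (ordge_le le_n gn.1).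
  by apply: codim_ideal2_homo eu; [apply: nz gn | apply: nz gn'].
have le12 : (n2 <= n1)%N by apply: le w1 w2 _ c1 c2.
exists (n1 - n2)%N => g n gn; have [c gc] := codim_ideal2 (nz _ _ gn).
suff -> : ((n1 - n2) * n)%N = c by [].
have a1 : ordn (phi (g1 ^+ n)) (m.+1 * n) by rewrite rmorphXn; apply: ordnX.
have a2 : ordn (phi (g * g2 ^+ n)) (n + m * n).
  by rewrite rmorphM rmorphXn; apply: ordnM => //; apply: ordnX.
have b1 := cX _ _ _ n w1 c1.
have b2 := codim_ideal2M (nz _ _ gn) gc (cX _ _ _ n w2 c2).
have le1 := le _ _ _ _ _ _ a1 a2 _ b1 b2.
have le2 := le _ _ _ _ _ _ a2 a1 _ b2 b1.
have {}le1 : (c + n * n2 <= n * n1)%N by apply: le1; rewrite mulSn.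
have {}le2 : (n * n1 <= c + n * n2)%N by apply: le2; rewrite mulSn.
nia.
Qed.

End ArcValuation.

(** * Derivatives along arcs *)

Section Derivations.
Variable K : fieldType.
Implicit Types (f g h l : fps2 K) (phi : {lrmorphism fps2 K -> fps1 K}).

Local Notation X := (fpsX K).
Local Notation Y := (fpsY K).

Lemma dxD f g : dx (f + g) = dx f + dx g.
Proof. by apply: fps2P => i j /=; rewrite mulrnDl. Qed.

Lemma dyD f g : dy (f + g) = dy f + dy g.
Proof. by apply: fps2P => i j /=; rewrite mulrnDl. Qed.

Lemma dxZ c f : dx (c *: f) = c *: dx f.
Proof. by apply: fps2P => i j /=; rewrite mulrnAr. Qed.

Lemma dyZ c f : dy (c *: f) = c *: dy f.
Proof. by apply: fps2P => i j /=; rewrite mulrnAr. Qed.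

Lemma dxC c : dx c%:A = 0 :> fps2 K.
Proof. by apply: fps2P => i j /=; rewrite mulr0 mul0rn. Qed.

Lemma dyC c : dy c%:A = 0 :> fps2 K.
Proof. by apply: fps2P => i j /=; rewrite andbF mulr0 mul0rn. Qed.

Lemma dxE f i j : dx f i j = f i.+1 j *+ i.+1. Proof. by []. Qed.
Lemma dyE f i j : dy f i j = f i j.+1 *+ j.+1. Proof. by []. Qed.

Lemma dxXM f : dx (X * f) = f + X * dx f.
Proof.
apply: fps2P => i j; rewrite dxE coef2D !coef2XM.
by case: i => [|i] /=; rewrite ?addr0 // mulrS.
Qed.

Lemma dxYM f : dx (Y * f) = Y * dx f.
Proof.
by apply: fps2P => i j; rewrite dxE !coef2YM; case: j; rewrite ?mul0rn.
Qed.

Lemma dyXM f : dy (X * f) = X * dy f.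
Proof.
by apply: fps2P => i j; rewrite dyE !coef2XM; case: i; rewrite ?mul0rn.
Qed.

Lemma dyYM f : dy (Y * f) = f + Y * dy f.
Proof.
apply: fps2P => i j; rewrite dyE coef2D !coef2YM.
by case: j => [|j] /=; rewrite ?addr0 // mulrS.
Qed.

(** The defect of a Leibniz rule is linear over x and y. *)
Lemma derivation_eq0 (E : fps2 K -> fps2 K) :
  {morph E : f g / f + g} -> (forall c, E c%:A = 0) ->
  (forall f, E (X * f) = X * E f) -> (forall f, E (Y * f) = Y * E f) ->
  forall f, E f = 0.
Proof.
move=> ED EC EX EY f; apply: ge2_all => n; elim: n f => [//|n IH] f.
rewrite [f]fps2_recl !ED EC EX EY add0r -add1n.
by apply: ge2D; apply: ge2M => //; apply: ge2_1.
Qed.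

Lemma dxM f g : dx (f * g) = dx f * g + f * dx g.
Proof.
apply/eqP; rewrite -subr_eq0; apply/eqP.
pose E u := dx (u * g) - (dx u * g + u * dx g); rewrite -/(E f).
apply: derivation_eq0 => [u v|c|u|u]; rewrite /E.
- by rewrite mulrDl !dxD; ring.
- by rewrite !mulr_algl dxZ dxC mul0r add0r subrr.
- by rewrite -mulrA !dxXM; ring.
- by rewrite -mulrA !dxYM; ring.
Qed.

Lemma dyM f g : dy (f * g) = dy f * g + f * dy g.
Proof.
apply/eqP; rewrite -subr_eq0; apply/eqP.
pose E u := dy (u * g) - (dy u * g + u * dy g); rewrite -/(E f).
apply: derivation_eq0 => [u v|c|u|u]; rewrite /E.
- by rewrite mulrDl !dyD; ring.
- by rewrite !mulr_algl dyZ dyC mul0r add0r subrr.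
- by rewrite -mulrA !dyXM; ring.
- by rewrite -mulrA !dyYM; ring.
Qed.

Lemma chain_rule phi f :
  deriv1 (phi f) = phi (dx f) * deriv1 (phi X) + phi (dy f) * deriv1 (phi Y).
Proof.
apply/eqP; rewrite -subr_eq0; apply/eqP.
pose E u := deriv1 (phi u) -
  (phi (dx u) * deriv1 (phi X) + phi (dy u) * deriv1 (phi Y)).
rewrite -/(E f).
have ED u v : E (u + v) = E u + E v.
  by rewrite /E dxD dyD !rmorphD deriv1D /=; ring.
have EC c : E c%:A = 0.
  rewrite /E dxC dyC !rmorph0 rmorph_alg deriv1Z deriv11 scaler0.
  by rewrite !mul0r addr0 subr0.
have EX u : E (X * u) = phi X * E u.
  by rewrite /E dxXM dyXM rmorphM deriv1M rmorphD !rmorphM /=; ring.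
have EY u : E (Y * u) = phi Y * E u.
  by rewrite /E dxYM dyYM rmorphM deriv1M rmorphD !rmorphM /=; ring.
apply: ordge_all => n; elim: n f => [//|n IH] f.
rewrite [f]fps2_recl !ED EC EX EY add0r -add1n.
by apply: ordgeD; apply: ordgeM => //; [apply: arcX_ordge|apply: arcY_ordge].
Qed.

Lemma ordge_deriv1 (u : fps1 K) n : ordn u n -> ordge n.-1 (deriv1 u).
Proof.
move=> [hu _] i lt_i /=; rewrite hu ?mul0rn //.
by case: n hu lt_i.
Qed.

Lemma ordn_deriv1 (u : fps1 K) n : ordn u n -> n%:R != 0 :> K ->
  ordn (deriv1 u) n.-1.
Proof.
move=> un n0; split; first exact: ordge_deriv1.
case: n n0 un => [|n] n0 [_ un]; first by rewrite eqxx in n0.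
by rewrite /= -mulr_natr mulf_neq0.
Qed.

(** When n vanishes in K, differentiation kills the leading term. *)
Lemma deriv1_ordn (u : fps1 K) n : ordn u n -> n%:R = 0 :> K ->
  ordge n (deriv1 u).
Proof.
move=> un n0 i; rewrite leq_eqVlt => /orP[/eqP ei|lt_i].
  by rewrite /= -ei in n0 *; rewrite -mulr_natr n0 mulr0.
by rewrite (ordge_deriv1 un) //; lia.
Qed.

Lemma regular_parameterP l : regular_parameter l <->
  l 0%N 0%N = 0 /\ (dx l 0%N 0%N != 0 \/ dy l 0%N 0%N != 0).
Proof.
split=> [[lo [i [j [e lij]]]]|[l0 h]].
  split; first exact: lo.
  have [[ei ej]|[ei ej]] : (i = 0 /\ j = 1 \/ i = 1 /\ j = 0)%N by lia.
    by right; rewrite ei ej in lij.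
  by left; rewrite ei ej in lij.
split; first by case=> [|i] [|j].
by case: h => /= h; [exists 1%N, 0%N | exists 0%N, 1%N].
Qed.

Lemma regular_irreducible l : regular_parameter l -> irreducible l.
Proof.
move=> lr; have ln := has_order_neq0 lr; split; first exact/eqP.
  by rewrite fps2_unitE; case: lr => -> //; rewrite eqxx.
move=> b c e.
have [m bm] : exists m, has_order b m.
  by apply: has_order_ex => b0; rewrite e b0 mul0r in ln.
have [n cn] : exists n, has_order c n.
  by apply: has_order_ex => c0; rewrite e c0 mulr0 in ln.
have emn : 1%N = (m + n)%N.
  by apply: (has_order_uniq lr); rewrite e; apply: has_orderM.
case: m emn bm => [|m] emn bm; first by left; apply: has_order0_unit.
by right; apply: has_order0_unit; have <- : n = 0%N; first lia.
Qed.

(** One variable z generates the maximal ideal modulo l, so codim (z, l) = 1 is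
the product of kappa and ord (phi z): both are 1.  The tangent vector
(x', y') of the arc is orthogonal to the gradient of l, hence parallel to
(l_y, - l_x), which gives the second part. *)
Lemma regular_arc l phi :
  regular_parameter l -> phi l = 0 -> primitive_arc phi ->
  (forall g n, ordn (phi g) n -> codim (ideal2 g l) n) /\
  exists a b, [/\ ordn a 0, ordn b 0 &
    forall g, deriv1 (phi g) * a = phi (polar l g) * b].
Proof.
move=> lr lk prim; have [l0 dl] := (regular_parameterP l).1 lr.
have [kappa kE] := codim_ordn (regular_irreducible lr) lk prim.
have nt := primitive_arc_neq0 prim.
pose u := FPS2 (fun i j => l i.+1 j) : fps2 K.
pose v := FPS2 (fun i j => if i is 0%N then l 0%N j.+1 else 0) : fps2 K.
have el : l = X * u + Y * v by rewrite {1}[l]fps2_recl l0 scale0r add0r.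
have chain := chain_rule phi l; rewrite lk deriv10 in chain.
have unitord g : g 0%N 0%N != 0 -> ordn (phi g) 0.
  by move=> g0; split=> //; rewrite arc_coef0.
have key (z : fps2 K) : z 0%N 0%N = 0 -> ideal2 z l X -> ideal2 z l Y ->
    (phi z = 0 -> False) -> kappa = 1%N /\ ordn (phi z) 1.
  move=> z0 zX zY /eqP/ordn_ex[n zn]; have := kE _ _ zn.
  have c1 : codim (ideal2 z l) 1.
    by apply: codim_maximal => //; [apply: ideal2_ideal | apply: ideal2_proper].
  move/(codim_uniq (ideal2_subspace _ _) c1)/esym/eqP.
  by rewrite muln_eq1 => /andP[/eqP -> /eqP e2]; rewrite -e2.
have fin : kappa = 1%N -> forall g n, ordn (phi g) n -> codim (ideal2 g l) n.
  by move=> k1 g n /kE; rewrite k1 mul1n.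
case: dl => dl.
- have [w uw] : exists w, u * w = 1 by apply: fps2_unit00.
  have [||||k1 oY] := key Y.
  + by [].
  + exists (- v * w), w; rewrite el.
    by transitivity (X * (u * w)); [rewrite uw mulr1 | ring].
  + by exists 1, 0; rewrite mul1r mul0r addr0.
  + move=> y0; have := lk; rewrite el rmorphD !rmorphM /= y0 mul0r addr0.
    case/fps1_mulf_eq0 => [x0|/eqP]; first by case: nt.
    by apply/negP; apply: ordn_neq0 (unitord u dl).
  split; first exact: fin.
  have odY : ordn (deriv1 (phi Y)) 0.
    by apply: (ordn_deriv1 oY); rewrite oner_neq0.
  exists (phi (dx l)), (- deriv1 (phi Y)); split; first exact: unitord.
    split=> //; rewrite /= oppr_eq0; exact: odY.2.
  move=> g; rewrite (chain_rule phi g) rmorphB !rmorphM /=.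
  apply/eqP; rewrite -subr_eq0.
  have -> : (phi (dx g) * deriv1 (phi X) + phi (dy g) * deriv1 (phi Y)) *
      phi (dx l) - (phi (dx g) * phi (dy l) - phi (dy g) * phi (dx l)) *
      - deriv1 (phi Y) =
    phi (dx g) *
      (phi (dx l) * deriv1 (phi X) + phi (dy l) * deriv1 (phi Y)) by ring.
  by rewrite -chain mulr0.
- have [w vw] : exists w, v * w = 1 by apply: fps2_unit00.
  have [||||k1 oX] := key X.
  + by [].
  + by exists 1, 0; rewrite mul1r mul0r addr0.
  + exists (- u * w), w; rewrite el.
    by transitivity (Y * (v * w)); [rewrite vw mulr1 | ring].
  + move=> x0; have := lk; rewrite el rmorphD !rmorphM /= x0 mul0r add0r.
    case/fps1_mulf_eq0 => [y0|/eqP]; first by case: nt.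
    by apply/negP; apply: ordn_neq0 (unitord v dl).
  split; first exact: fin.
  have odX : ordn (deriv1 (phi X)) 0.
    by apply: (ordn_deriv1 oX); rewrite oner_neq0.
  exists (phi (dy l)), (deriv1 (phi X)); split=> //; first exact: unitord.
  move=> g; rewrite (chain_rule phi g) rmorphB !rmorphM /=.
  apply/eqP; rewrite -subr_eq0.
  have -> : (phi (dx g) * deriv1 (phi X) + phi (dy g) * deriv1 (phi Y)) *
      phi (dy l) - (phi (dx g) * phi (dy l) - phi (dy g) * phi (dx l)) *
      deriv1 (phi X) =
    phi (dy g) *
      (phi (dx l) * deriv1 (phi X) + phi (dy l) * deriv1 (phi Y)) by ring.
  by rewrite -chain mulr0.
Qed.

(** If l_y is a unit, q = f_y and eps = l_y work: f_x l_y = P + f_y l_x, both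
modulo P and along arcs on which P vanishes; if l_x is a unit, exchange the
variables. *)
Lemma conormal l f : regular_parameter l -> exists q eps : fps2 K, [/\
  eps 0%N 0%N != 0,
  forall r, ideal2 (dx f) (dy f) r <-> ideal2 q (polar l f) r &
  forall phi, phi (polar l f) = 0 ->
    deriv1 (phi f) * phi eps = phi q * deriv1 (phi l)].
Proof.
move=> /regular_parameterP[_ [|] /[dup] dl /fps2_unit00[w dw]].
- exists (dx f), (dx l); split=> // [r|phi].
    split=> -[a [b ->]].
      exists (a + b * dy l * w), (- b * w); rewrite /polar.
      transitivity (a * dx f + b * dy f * (dx l * w)).
        by rewrite dw mulr1.
      by ring.
    by exists (a + b * dy l), (- b * dx l); rewrite /polar; ring.
  rewrite rmorphB !rmorphM /= => /eqP; rewrite subr_eq0 => /eqP pk.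
  rewrite (chain_rule phi f) (chain_rule phi l) mulrDl mulrDr.
  congr (_ + _); first by ring.
  by rewrite mulrA pk; ring.
- exists (dy f), (dy l); split=> // [r|phi].
    split=> -[a [b ->]].
      exists (b + a * dx l * w), (a * w); rewrite /polar.
      transitivity (b * dy f + a * dx f * (dy l * w)).
        by rewrite dw mulr1 addrC.
      by ring.
    by exists (b * dy l), (a - b * dx l); rewrite /polar; ring.
  rewrite rmorphB !rmorphM /= => /eqP; rewrite subr_eq0 => /eqP pk.
  rewrite (chain_rule phi f) (chain_rule phi l) mulrDl mulrDr.
  congr (_ + _); last by ring.
  by rewrite [RHS]mulrA -pk; ring.
Qed.

End Derivations.

Lemma not_cong0P (K : fieldType) p n : has_char K p ->
  not_cong0 p (Posz n)%:E <-> n%:R != 0 :> K.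
Proof.
move=> hp; rewrite /not_cong0.
have -> : (n%:R == 0 :> K) = (p %| n)%N.
  case: p hp => [|p] hp; first by rewrite ((pcharf0P K).1 hp) dvd0n.
  by rewrite -(dvdn_pcharf hp).
rewrite mod0z modz_nat; split=> [h|/negP h [e]].
  by apply/negP => /eqP e; apply: h; rewrite e.
by apply: h; apply/eqP.
Qed.

(** * Summation over the factors of a series *)

Section Factors.
Variable K : closedFieldType.
Implicit Types (f g h l q : fps2 K) (phi : {lrmorphism fps2 K -> fps1 K}).

Local Notation X := (fpsX K).
Local Notation Y := (fpsY K).

Lemma codim0 (W : fps2 K -> Prop) v : codim W 0 -> W v.
Proof.
case=> s /(_ v) [c [wv _]].
by rewrite big_ord0 subr0 in wv.
Qed.

(** A subspace of (h) is contained in every (z^k, h), whose codimension is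
proportional to k. *)
Lemma codim_kernel_none phi h J : irreducible h -> phi h = 0 ->
  primitive_arc phi -> (forall v, J v -> phi v = 0) -> forall n, ~ codim J n.
Proof.
move=> hi hk prim Jk n cJ.
have [kappa kE] := codim_ordn hi hk prim.
have [z [z0 zn]] : exists z : fps2 K, z 0%N 0%N = 0 /\ phi z <> 0.
  by case: (primitive_arc_neq0 prim) => ?; [exists X | exists Y].
have /eqP/ordn_ex[e ze] := zn.
have h0 : h 0%N 0%N = 0 by rewrite -(arc_coef0 phi) hk.
have pos : (0 < kappa * e)%N.
  rewrite lt0n; apply/eqP => ke0; have := kE _ _ ze; rewrite ke0.
  by move/(codim0 1); apply: ideal2_proper.
have zek : ordn (phi (z ^+ n.+1)) (e * n.+1) by rewrite rmorphXn; apply: ordnX.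
have := le_codim (ideal2_subspace _ _) _ cJ (kE _ _ zek).
suff sub v : J v -> ideal2 (z ^+ n.+1) h v by move=> /(_ sub); nia.
move/Jk/(arc_kernel hi hk prim) => [c ->].
by exists 0, c; rewrite mul0r add0r.
Qed.

Lemma irreducible_arc h : irreducible h ->
  exists2 phi : {lrmorphism fps2 K -> fps1 K}, phi h = 0 & primitive_arc phi.
Proof.
case=> /eqP h0 hu _; have [m hm m0] := nonunit_order h0 hu.
exact: has_arc_ex hm m0.
Qed.

(** Additivity of intersection numbers: multiplication by h embeds R/(g,Q) into
R/(g,hQ), since h is prime and does not divide g. *)
Lemma codim_mul_irreducible g h Q n m : irreducible h ->
  codim (ideal2 g h) n -> codim (ideal2 g Q) m ->
  codim (ideal2 g (h * Q)) (m + n).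
Proof.
move=> hi ch cQ; have [phi hk prim] := irreducible_arc hi.
have g0 : phi g <> 0.
  move=> gk; apply: (codim_kernel_none hi hk prim _ ch) => _ [a [b ->]].
  by rewrite rmorphD !rmorphM /= gk hk !mulr0 addr0.
have hn : h <> 0 by case: hi => /eqP.
apply: (@codim_mul _ h _ _ _ _ _ _ _ _ _ _ cQ ch); try exact: ideal2_ideal.
  move=> u; split=> [[a [b e]]|[a [b ->]]]; last by exists (h * a), b; ring.
  have : phi (a * g) = 0.
    rewrite (_ : a * g = h * (u - b * Q)) ?rmorphM /= ?hk ?mul0r //.
    by rewrite mulrBr e; ring.
  rewrite rmorphM => /fps1_mulf_eq0[/= /(arc_kernel hi hk prim)[c ec]|//].
  exists c, b; apply: (fps2_mulfI hn); rewrite e ec; ring.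
move=> v; split=> [[a [b ->]]|[u [a [b e]]]].
  by exists b, a, 0; ring.
by exists a, (b * Q + u); rewrite -[v](subrK (h * u)) e; ring.
Qed.

Lemma factorization P : P <> 0 -> exists u (s : seq (fps2 K)),
  [/\ u \is a GRing.unit, forall h, h \in s -> irreducible h &
      P = u * \prod_(h <- s) h].
Proof.
move=> /has_order_ex[n]; elim/ltn_ind: n P => n IH P Pn.
have [Pu|Pnu] := boolP (P \is a GRing.unit).
  by exists P, [::]; rewrite big_nil mulr1.
have [Pi|nPi] := pselect (irreducible P).
  exists 1, [:: P]; rewrite unitr1 big_seq1 mul1r; split=> // h.
  by rewrite inE => /eqP ->.
have P0 := has_order_neq0 Pn.
have [b [c [e bu cu]]] : exists b c,
    [/\ P = b * c, b \isn't a GRing.unit & c \isn't a GRing.unit].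
  apply: contrapT => h; apply: nPi; split=> //; first exact/eqP.
  move=> b c e; apply: contrapT => /not_orP[/negP bu /negP cu].
  by apply: h; exists b, c.
have [|mb bm mb0] := @nonunit_order _ b _ bu.
  by move=> b0; apply: P0; rewrite e b0 mul0r.
have [|mc cm mc0] := @nonunit_order _ c _ cu.
  by move=> c0; apply: P0; rewrite e c0 mulr0.
have en : n = (mb + mc)%N.
  by apply: (has_order_uniq Pn); rewrite e; apply: has_orderM.
have [|u [s [uu si es]]] := IH mb _ _ bm; first lia.
have [|u' [s' [uu' si' es']]] := IH mc _ _ cm; first lia.
exists (u * u'), (s ++ s'); split; first by rewrite unitrM uu.
  by move=> h; rewrite mem_cat => /orP[/si|/si'].
by rewrite e es es' big_cat /=; ring.
Qed.

Definition good_factor f h := exists2 n, codim (ideal2 f h) n & n%:R != 0 :> K.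

(** The local inequality; it is void when (q, h) has infinite codimension. *)
Definition branch_bound f l q h := exists nf nl, [/\ codim (ideal2 f h) nf,
  codim (ideal2 l h) nl & forall nq, codim (ideal2 q h) nq ->
    (nf <= nq + nl)%N /\ ((nf = nq + nl)%N <-> nf%:R != 0 :> K)].

Lemma sum_branches f l q u (s : seq (fps2 K)) : u \is a GRing.unit ->
  (forall h, h \in s -> irreducible h /\ branch_bound f l q h) ->
  exists nf nl, [/\ codim (ideal2 f (u * \prod_(h <- s) h)) nf,
    codim (ideal2 l (u * \prod_(h <- s) h)) nl &
    (forall h, h \in s -> exists n, codim (ideal2 q h) n) ->
    exists nq, [/\ codim (ideal2 q (u * \prod_(h <- s) h)) nq,
      (nf <= nq + nl)%N &
      (nf = nq + nl)%N <-> forall h, h \in s -> good_factor f h]].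
Proof.
move=> uu; elim: s => [_|h s IH hs].
  have c0 g : codim (ideal2 g (u * \prod_(h <- [::]) h)) 0.
    apply: codimT => v; exists 0, (v * u^-1).
    by rewrite big_nil mulr1 mul0r add0r divrK.
  by exists 0%N, 0%N; split=> // _; exists 0%N.
have [hi [af [al [caf cal ba]]]] := hs h (mem_head _ _).
have {}IH := IH (fun g gs => hs g (mem_behead (s := h :: s) gs)).
have [nf [nl [cf cl bq]]] := IH.
have eP : u * \prod_(g <- h :: s) g = h * (u * \prod_(g <- s) g).
  by rewrite big_cons mulrCA.
rewrite eP; exists (nf + af)%N, (nl + al)%N; split.
- exact: codim_mul_irreducible.
- exact: codim_mul_irreducible.
move=> fin; have [aq caq] := fin h (mem_head _ _).
have [lea eqa] := ba _ caq.
have [nq [cq le_n eq_n]] :=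
  bq (fun g gs => fin g (mem_behead (s := h :: s) gs)).
exists (nq + aq)%N; split; first exact: codim_mul_irreducible.
  by lia.
split=> [e|goods].
  have ea : af = (aq + al)%N by lia.
  have en : nf = (nq + nl)%N by lia.
  move=> g; rewrite inE => /orP[/eqP->|]; last exact: (eq_n.1 en).
  by exists af => //; apply/eqa.
have [n cn n0] := goods h (mem_head _ _).
have en : n = af by apply: codim_uniq (ideal2_subspace _ _) cn caf.
have ea : af = (aq + al)%N by apply/eqa; rewrite -en.
have en' : nf = (nq + nl)%N.
  by apply/eq_n => g gs; apply: goods; rewrite inE gs orbT.
lia.
Qed.

End Factors.

(** * The branches of the polar *)

Section PolarBranches.
Variables (K : closedFieldType) (p : nat).
Hypothesis hp : has_char K p.
Implicit Types (f g h l q : fps2 K) (phi : {lrmorphism fps2 K -> fps1 K}).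

Lemma i0E f g n : codim (ideal2 f g) n -> i0 f g = (Posz n)%:E.
Proof. exact/quotient_dimE/ideal2_subspace. Qed.

Lemma not_cong0_codim f g n : codim (ideal2 f g) n ->
  not_cong0 p (i0 f g) <-> n%:R != 0 :> K.
Proof. by move=> c; rewrite (i0E c); apply: not_cong0P. Qed.

(** The series a and b are units of K[[t]], so the polar of g has the order of
(phi g)' along the arc. *)
Lemma ordn_polar l phi g n a b : ordn a 0 -> ordn b 0 ->
  deriv1 (phi g) * a = phi (polar l g) * b ->
  ordn (phi g) n -> n%:R != 0 :> K -> ordn (phi (polar l g)) n.-1.
Proof.
move=> a0 b0 e gn n0.
have := ordnM (ordn_deriv1 gn n0) a0; rewrite addn0 e => Pb.
have /ordn_ex[k Pk] : phi (polar l g) != 0.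
  by apply/eqP => P0; have := ordn_neq0 Pb; rewrite P0 mul0r eqxx.
by have := ordnM Pk b0; rewrite addn0 => /(ordn_uniq Pb) ->.
Qed.

(** The series q of [conormal] satisfies the local inequality along each branch
h of the polar, and a branch common to q and the polar makes both the Milnor
number infinite and i0(f,h) zero in K. *)
Lemma polar_branches l f : reduced f -> regular_parameter l -> ~ divides l f ->
  not_cong0 p (i0 f l) ->
  (forall h, irreducible_factor h (polar l f) -> not_cong0 p (i0 l h)) ->
  exists q N, [/\ (0 < N)%N, codim (ideal2 f l) N,
    codim (ideal2 l (polar l f)) N.-1, polar l f <> 0 &
    (forall r, ideal2 (dx f) (dy f) r <-> ideal2 q (polar l f) r) /\
    forall h, irreducible_factor h (polar l f) -> branch_bound f l q h /\
      ((forall n, ~ codim (ideal2 q h) n) ->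
        (forall n, ~ codim (ideal2 q (polar l f)) n) /\ ~ good_factor f h)].
Proof.
move=> fred lr ndiv hi hii.
have li := regular_irreducible lr.
have [psi psil psi_prim] := irreducible_arc li.
have [codim_l [a [b [a0 b0 ab]]]] := regular_arc lr psil psi_prim.
have psif : psi f != 0.
  by apply/eqP => /(arc_kernel li psil psi_prim).
have [N fN] := ordn_ex psif.
have cfl := codim_l _ _ fN.
have N0 : N%:R != 0 :> K by apply/(not_cong0_codim cfl).
have Npos : (0 < N)%N by rewrite lt0n; apply: contraNneq N0 => ->.
have PN := ordn_polar a0 b0 (ab f) fN N0.
have psiP : psi (polar l f) <> 0 by have /eqP := ordn_neq0 PN.
have [q [eps [eps0 idE derE]]] := conormal f lr.
exists q, N; split=> //.
- rewrite (_ : ideal2 l (polar l f) = ideal2 (polar l f) l).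
    exact: codim_l.
  by apply/funext => r; apply/propext; apply: ideal2C.
- by move=> P0; apply: psiP; rewrite P0 rmorph0.
split=> // h hP; have [hirr [cP eP]] := hP.
have [phi phih prim] := irreducible_arc hirr.
have phiP : phi (polar l f) = 0 by rewrite eP rmorphM /= phih mulr0.
have ker := arc_kernel hirr phih prim.
have [kappa kE] := codim_ordn hirr phih prim.
have psih : psi h <> 0.
  by move=> h0; apply: psiP; rewrite eP rmorphM /= h0 mulr0.
have /eqP phil : phi l != 0.
  apply/eqP => /ker [c ec]; have [_ _ /(_ _ _ ec)] := li.
  case=> [cu|hu]; last by case: hirr => _ /negP.
  by apply: psih; rewrite -[h](mulKr cu) -ec rmorphM /= psil mulr0.
have /eqP/ordn_ex[bl lbl] := phil.
have cl := kE _ _ lbl.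
have := hii _ hP; rewrite (not_cong0_codim cl) natrM mulf_eq0 negb_or.
case/andP => kap0 bl0.
have blpos : (0 < bl)%N by rewrite lt0n; apply: contraNneq bl0 => ->.
have dl := ordn_deriv1 lbl bl0.
have derf := derE _ phiP.
have epsn : ordn (phi eps) 0 by split=> //; rewrite arc_coef0.
have gradk : phi q = 0 -> phi (dx f) = 0 /\ phi (dy f) = 0.
  move=> qk; have sub r : ideal2 (dx f) (dy f) r -> phi r = 0.
    move/idE => [u [v ->]].
    by rewrite rmorphD !rmorphM /= qk phiP !mulr0 addr0.
  by split; apply: sub; [exists 1, 0 | exists 0, 1];
    rewrite mul1r mul0r ?addr0 ?add0r.
(* If h divided f, then q and both partial derivatives of f would vanish on h.
Writing f = c h with c prime to h, so would both derivatives of h, so that h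
would divide its own polar; along l the polar of h has smaller order than h. *)
have phif : phi f <> 0.
  move=> fk; have [c ec] := ker _ fk.
  have qk : phi q = 0.
    have := derf; rewrite fk deriv10 mul0r => /esym /fps1_mulf_eq0[//|/eqP].
    by have /negP := ordn_neq0 dl.
  have [fx fy] := gradk qk.
  have ck : phi c <> 0.
    move=> /ker [d ed]; apply: (fred h hirr).
    by exists d; rewrite ec ed expr2 mulrA.
  have hx : phi (dx h) = 0.
    move: fx; rewrite ec dxM rmorphD !rmorphM /= phih mulr0 add0r.
    by case/fps1_mulf_eq0.
  have hy : phi (dy h) = 0.
    move: fy; rewrite ec dyM rmorphD !rmorphM /= phih mulr0 add0r.
    by case/fps1_mulf_eq0.
  have [d ed] : divides h (polar l h).
    by apply: ker; rewrite rmorphB !rmorphM /= hx hy !mul0r subrr.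
  have /eqP/ordn_ex[m hm] := psih.
  have clh : codim (ideal2 h l) m := codim_l _ _ hm.
  have m0 : m%:R != 0 :> K.
    by apply/(not_cong0_codim clh); rewrite i0C; apply: hii.
  have := ordn_polar a0 b0 (ab h) hm m0; rewrite ed rmorphM /=.
  move/(ordge_ordn (ordgeMl (psi d) hm.1)).
  have : (0 < m)%N by rewrite lt0n; apply: contraNneq m0 => ->.
  by lia.
have /eqP/ordn_ex[n fn] := phif.
have cf := kE _ _ fn.
have npos : (0 < n)%N.
  apply: (@ordge_ordn _ _ _ 1 _ fn) => -[|] // _.
  rewrite arc_coef0 -(arc_coef0 psi); exact: fN.1.
have [qk|/eqP/eqP/ordn_ex[c qc]] := eqVneq (phi q) 0.
  have n0 : n%:R = 0 :> K.
    apply/eqP; apply: contrapT => /negP n0.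
    have := ordn_neq0 (ordnM (ordn_deriv1 fn n0) epsn).
    by rewrite derf qk mul0r eqxx.
  have none J : (forall v, J v -> phi v = 0) -> forall n, ~ codim J n.
    exact: codim_kernel_none hirr phih prim.
  split.
    exists (kappa * n)%N, (kappa * bl)%N; split=> // m cm; exfalso.
    apply: none cm => _ [u [v ->]].
    by rewrite rmorphD !rmorphM /= qk phih !mulr0 addr0.
  move=> _; split.
    apply: none => _ [u [v ->]].
    by rewrite rmorphD !rmorphM /= qk phiP !mulr0 addr0.
  case=> m cm; rewrite (codim_uniq (ideal2_subspace _ _) cm cf).
  by rewrite natrM n0 mulr0 eqxx.
split; last by move=> /(_ _ (kE _ _ qc)).
have rhs : ordn (phi q * deriv1 (phi l)) (c + bl.-1) by apply: ordnM.
rewrite -derf in rhs.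
exists (kappa * n)%N, (kappa * bl)%N; split=> // m cm.
rewrite (codim_uniq (ideal2_subspace _ _) cm (kE _ _ qc)).
rewrite natrM mulf_eq0 negb_or kap0 /= -mulnDr.
have kpos : (0 < kappa)%N by rewrite lt0n; apply: contraNneq kap0 => ->.
have low := ordge_ordn (ordgeM (ordge_deriv1 fn) epsn.1) rhs.
rewrite leq_mul2l; split; first by apply/orP; right; lia.
split=> [/eqP|n0].
  rewrite eqn_mul2l (gtn_eqF kpos) /= => /eqP en.
  apply/eqP => n0; have := ordge_ordn (ordgeM (deriv1_ordn fn n0) epsn.1) rhs.
  by lia.
have := ordn_uniq rhs (ordnM (ordn_deriv1 fn n0) epsn) => e.
by congr (_ * _)%N; lia.
Qed.

End PolarBranches.

Theorem proposition2p3 (K : closedFieldType) (p : nat) (hp : has_char K p)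
    (f l : fps2 K) (f_reduced : reduced f) (l_regular : regular_parameter l)
    (l_ndiv_f : ~ divides l f)
    (hi : not_cong0 p (i0 f l))
    (hii : forall h : fps2 K,
       irreducible_factor h (polar l f) -> not_cong0 p (i0 l h)) :
  (i0 f (polar l f) <= milnor f + i0 f l - 1)%E /\
  (i0 f (polar l f) = (milnor f + i0 f l - 1)%E <->
   forall h : fps2 K,
     irreducible_factor h (polar l f) -> not_cong0 p (i0 f h)).
Proof.
have [q [N [N0 cfl clP P0 [idE bP]]]] :=
  polar_branches hp f_reduced l_regular l_ndiv_f hi hii.
set P := polar l f in P0 clP idE bP *.
have milnorE : milnor f = i0 q P.
  rewrite /milnor /i0; congr quotient_dim; apply/funext => r.
  exact/propext/idE.
have good h :
    irreducible_factor h P -> not_cong0 p (i0 f h) <-> good_factor f h.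
  case/bP => -[nf [nl [cf _ _]]] _; rewrite (not_cong0_codim hp cf).
  split=> [n0|[m /(codim_uniq (ideal2_subspace _ _) cf) <-]] //.
  by exists nf.
have [u [s [uu si eP]]] := factorization P0.
have sP h : h \in s -> irreducible_factor h P.
  move=> hs; split; first exact: si.
  exists (u * \prod_(g <- rem h s) g).
  by rewrite eP (perm_big _ (perm_to_rem hs)) big_cons /=; ring.
have sb h (hs : h \in s) := conj (si h hs) (bP h (sP h hs)).1.
have [nf [nl [cf cl bq]]] := sum_branches uu sb.
rewrite -eP in cf cl bq.
have enl : nl = N.-1 := codim_uniq (ideal2_subspace _ _) cl clP.
rewrite milnorE (i0E cf) (i0E cfl).
(* The Milnor number is finite exactly when q shares no factor with P. *)
have [fin|] := pselect (forall h, irreducible_factor h P ->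
    exists n, codim (ideal2 q h) n).
  have [nq [cq le_n eq_n]] := bq (fun h hs => fin h (sP h hs)).
  rewrite (i0E cq).
  have -> : ((Posz nq)%:E + (Posz N)%:E - 1 = (Posz (nq + nl))%:E)%E.
    transitivity ((Posz nq + Posz N - 1)%:E : \bar int); first by [].
    by congr EFin; lia.
  split; first by rewrite lee_fin lez_nat.
  split=> [[e] h hP|hs].
(* An arbitrary factor h is put first in a factorization of P. *)
    apply/(good _ hP); have [hirr [P' eP']] := hP.
    have P'0 : P' <> 0 by move=> P'0; apply: P0; rewrite eP' P'0 mul0r.
    have [v [t [vu ti eP'']]] := factorization P'0.
    have tP g : g \in h :: t -> irreducible_factor g P.
      rewrite inE => /orP[/eqP->//|gt]; split; first exact: ti.
      exists (h * v * \prod_(k <- rem g t) k).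
      by rewrite eP' eP'' (perm_big _ (perm_to_rem gt)) big_cons /=; ring.
    have tb g (gt : g \in h :: t) := conj (tP g gt).1 (bP g (tP g gt)).1.
    have [nf' [nl' [cf' cl' bq']]] := sum_branches vu tb.
    have eP3 : P = v * \prod_(g <- h :: t) g.
      by rewrite big_cons eP' eP''; ring.
    rewrite -eP3 in cf' cl' bq'.
    have [nq' [cq' _ [eq' _]]] := bq' (fun g gt => fin g (tP g gt)).
    apply: eq' (mem_head _ _).
    rewrite -(codim_uniq (ideal2_subspace _ _) cf cf').
    rewrite -(codim_uniq (ideal2_subspace _ _) cl cl').
    by rewrite -(codim_uniq (ideal2_subspace _ _) cq cq').
  congr (_%:E); congr Posz; apply/eq_n => h hs'.
  by apply/(good _ (sP _ hs'))/hs/sP.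
move=> /existsNP[h /not_implyP[hP /forallNP nq]].
have [_ /(_ nq)[nqP nh]] := bP _ hP.
have -> : i0 q P = +oo%E by apply: quotient_dim_oo.
rewrite (_ : (+oo + (Posz N)%:E - 1)%E = +oo%E :> \bar int) //.
split; first exact: leey.
by split=> // /(_ _ hP)/(good _ hP).
Qed.
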